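(* Let $c>0$ be sufficiently large, let $N_0\subset\mathbb{CP}^4$ be the quintic hypersurface $z_1z_4(z_0^3-z_1^3-z_4^3)-z_2z_3(cz_0^3-z_2^3-z_3^3)=0$ (which is nodal with exactly $49$ nodes), let $D_0\subset N_0$ be the divisor $z_3=z_4=0$, and let $\pi:N_1\to N_0$ be the blow-up of $D_0$ in $N_0$. Then there exist projective small resolutions of $N_1$.
   Context: A complex 3-fold is nodal if its germ at each singular point (node) is biholomorphic to that of $\{x_1x_4-x_2x_3=0\}\subset\mathbb C^4$ at $0$. A small resolution is a resolution of singularities whose exceptional set has codimension at least two (here, it replaces each node by a $\mathbb{CP}^1$); a projective small resolution is one whose total space is a projective (nonsingular) 3-fold. $N_1$ is a nodal 3-fold, $\pi:N_1\to N_0$ being a small morphism. *)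

(* Defs.v *)
From mathcomp Require Import all_boot all_order all_algebra.
From mathcomp Require Import mpoly complex.
From mathcomp Require Import boolp classical_sets reals.
Set Implicit Arguments.
Unset Strict Implicit.
Unset Printing Implicit Defensive.
Import GRing.Theory.
Local Open Scope ring_scope.
Local Open Scope classical_set_scope.

(* Classical algebraic geometry in products of projective spaces.  A product  *)
(* of k projective spaces with n homogeneous coordinates in total is encoded  *)
(* by the map b : 'I_n -> 'I_k sending a coordinate to the factor it belongs  *)
(* to; thus the product has dimension n - k.  A point is represented by a     *)
(* vector of coordinates x : 'rV_n that is nonzero in each factor; two such   *)
(* vectors are the same point when they differ by a rescaling of each factor. *)
(* Subsets are sets of representatives, and a map of points is given by a     *)
(* function on representatives.                                               *)
Section MultiProjective.
Variable K : fieldType.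

Definition mpoint n k (b : 'I_n -> 'I_k) : set 'rV[K]_n :=
  [set x | forall j, exists2 i, b i = j & x ord0 i != 0].

Definition same_point n k (b : 'I_n -> 'I_k) (x y : 'rV[K]_n) : Prop :=
  exists2 t : 'I_k -> K, (forall j, t j != 0)
    & forall i, y ord0 i = t (b i) * x ord0 i.

Definition peval n (p : {mpoly K[n]}) (x : 'rV[K]_n) : K :=
  p.@[fun i => x ord0 i].

Definition mhomog n k (b : 'I_n -> 'I_k) (d : 'I_k -> nat)
    (p : {mpoly K[n]}) : Prop :=
  forall m, m \in msupp p -> forall j, (\sum_(i < n | b i == j) m i)%N = d j.

Definition zeros n k (b : 'I_n -> 'I_k) (S : set {mpoly K[n]}) : set 'rV[K]_n :=
  [set x | mpoint b x /\ forall p, S p -> peval p x = 0].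

(* Zariski topology *)
Definition zclosed n k (b : 'I_n -> 'I_k) (Z : set 'rV[K]_n) : Prop :=
  exists2 S : set {mpoly K[n]},
    (forall p, S p -> exists d, mhomog b d p) & Z = zeros b S.

Definition zclosed_in n k (b : 'I_n -> 'I_k) (X Z : set 'rV[K]_n) : Prop :=
  exists2 F, zclosed b F & Z = X `&` F.

Definition zopen_in n k (b : 'I_n -> 'I_k) (X U : set 'rV[K]_n) : Prop :=
  exists2 F, zclosed b F & U = X `\` F.

Definition zclosure n k (b : 'I_n -> 'I_k) (A : set 'rV[K]_n) : set 'rV[K]_n :=
  [set x | forall F, zclosed b F -> A `<=` F -> F x].

Definition zdense_in n k (b : 'I_n -> 'I_k) (X A : set 'rV[K]_n) : Prop :=
  A `<=` X /\ X `<=` zclosure b A.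

Definition quasi_projective n k (b : 'I_n -> 'I_k) (X : set 'rV[K]_n) : Prop :=
  exists2 F, zclosed b F & zopen_in b F X.

Definition zirreducible n k (b : 'I_n -> 'I_k) (Z : set 'rV[K]_n) : Prop :=
  Z !=set0 /\
  forall F G, zclosed b F -> zclosed b G ->
    Z `<=` F `|` G -> Z `<=` F \/ Z `<=` G.

(* Krull dimension at most e: no chain Z 0 < ... < Z e.+1 of irreducible      *)
(* closed subsets of E.                                                       *)
Definition zdim_le n k (b : 'I_n -> 'I_k) (E : set 'rV[K]_n) (e : nat) : Prop :=
  ~ exists Z : nat -> set 'rV[K]_n,
      (forall i, (i <= e.+1)%N ->
         [/\ Z i `<=` E, zclosed_in b E (Z i) & zirreducible b (Z i)]) /\
      (forall i, (i <= e)%N -> Z i `<` Z i.+1).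

(* Regular maps: locally given, factor by factor of the target, by            *)
(* multihomogeneous forms of equal multidegree with no common zero.           *)
Definition regular_map n k (b : 'I_n -> 'I_k) n' k' (b' : 'I_n' -> 'I_k')
    (X : set 'rV[K]_n) (Y : set 'rV[K]_n') (phi : 'rV[K]_n -> 'rV[K]_n')
    : Prop :=
  (forall x, X x -> Y (phi x)) /\
  forall x, X x -> exists F : 'I_n' -> {mpoly K[n]},
    let evF y := \row_i peval (F i) y in
    [/\ exists d : 'I_k' -> 'I_k -> nat, forall i, mhomog b (d (b' i)) (F i),
        mpoint b' (evF x)
      & forall y, X y -> mpoint b' (evF y) -> same_point b' (evF y) (phi y)].

Definition isomorphism n k (b : 'I_n -> 'I_k) n' k' (b' : 'I_n' -> 'I_k')
    (X : set 'rV[K]_n) (Y : set 'rV[K]_n') (phi : 'rV[K]_n -> 'rV[K]_n')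
    : Prop :=
  regular_map b b' X Y phi /\
  exists psi : 'rV[K]_n' -> 'rV[K]_n,
    [/\ regular_map b' b Y X psi,
        forall x, X x -> same_point b (psi (phi x)) x
      & forall y, Y y -> same_point b' (phi (psi y)) y].

Definition birational n k (b : 'I_n -> 'I_k) n' k' (b' : 'I_n' -> 'I_k')
    (X : set 'rV[K]_n) (Y : set 'rV[K]_n') (phi : 'rV[K]_n -> 'rV[K]_n')
    : Prop :=
  exists U V, [/\ zopen_in b X U /\ zdense_in b X U,
                  zopen_in b' Y V /\ zdense_in b' Y V
                & isomorphism b b' U V phi].

(* The points of X over which phi has no local regular inverse.               *)
Definition exceptional_set n k (b : 'I_n -> 'I_k) n' k' (b' : 'I_n' -> 'I_k')
    (X : set 'rV[K]_n) (Y : set 'rV[K]_n') (phi : 'rV[K]_n -> 'rV[K]_n')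
    : set 'rV[K]_n :=
  [set x | X x /\
     ~ exists V, [/\ zopen_in b' Y V, V (phi x)
                   & isomorphism b b' (X `&` phi @^-1` V) V phi]].

Definition PP m : 'I_m.+1 -> 'I_1 := fun=> ord0.

Definition projective n k (b : 'I_n -> 'I_k) (X : set 'rV[K]_n) : Prop :=
  exists m (Y : set 'rV[K]_m.+1) phi,
    zclosed (@PP m) Y /\ isomorphism b (@PP m) X Y phi.

(* Nonsingular of pure dimension d: near each point, X is cut out by          *)
(* codim X = n - k - d equations with linearly independent differentials.     *)
(* By Euler's relations the rank may be computed on the homogeneous           *)
(* coordinates.                                                               *)
Definition smooth_of_dim n k (b : 'I_n -> 'I_k) (X : set 'rV[K]_n) (d : nat)
    : Prop :=
  X `<=` mpoint b /\
  forall x, X x -> exists r (f : 'I_r -> {mpoly K[n]}) (h : {mpoly K[n]}),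
    [/\ (r + k + d)%N = n,
        (forall i, exists e, mhomog b e (f i)) /\ (exists e, mhomog b e h),
        peval h x != 0,
        forall y, mpoint b y -> peval h y != 0 ->
          (X y <-> forall i, peval (f i) y = 0)
      & row_free (\matrix_(i < r, j < n) peval (mderiv j (f i)) x)].

Definition prod_factors n k (b : 'I_n -> 'I_k) n' k' (b' : 'I_n' -> 'I_k') :
    'I_(n + n') -> 'I_(k + k') :=
  fun i => match split i with
           | inl j => lshift k' (b j)
           | inr j => rshift k (b' j)
           end.

(* Blow-up of X along the closed subscheme g 0 = ... = g m = 0, for forms g i *)
(* of the same multidegree: the closure, in the product with P^m, of the      *)
(* graph of x |-> [g 0 x : ... : g m x].                                      *)
Definition blowup n k (b : 'I_n -> 'I_k) (X : set 'rV[K]_n)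
    m (g : 'I_m.+1 -> {mpoly K[n]}) : set 'rV[K]_(n + m.+1) :=
  zclosure (prod_factors b (@PP m))
    [set y | [/\ X (lsubmx y), mpoint (@PP m) (rsubmx y)
               & same_point (@PP m) (rsubmx y)
                   (\row_i peval (g i) (lsubmx y))]].

(* Codimension at least two in a 3-fold is dimension at most 3 - 2 = 1;       *)
(* properness of phi is automatic, its source being projective.               *)
Record projective_small_resolution n k (b : 'I_n -> 'I_k)
    n' k' (b' : 'I_n' -> 'I_k')
    (M : set 'rV[K]_n) (N : set 'rV[K]_n') (phi : 'rV[K]_n -> 'rV[K]_n')
    : Prop := ProjectiveSmallResolution {
  psr_quasi_projective : quasi_projective b M;
  psr_projective : projective b M;
  psr_smooth : smooth_of_dim b M 3;
  psr_regular : regular_map b b' M N phi;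
  psr_birational : birational b b' M N phi;
  psr_small : zdim_le b (exceptional_set b b' M N phi) 1
}.

End MultiProjective.

Arguments PP m : clear implicits.

Section Quintic.
Variable R : realType.
Local Open Scope complex_scope.

Definition z (i : nat) : {mpoly R[i][5]} := 'X_(inord i).

Definition quintic (c : R) : {mpoly R[i][5]} :=
  z 1 * z 4 * (z 0 ^+ 3 - z 1 ^+ 3 - z 4 ^+ 3)
  - z 2 * z 3 * ((c%:C)%:MP * z 0 ^+ 3 - z 2 ^+ 3 - z 3 ^+ 3).

Definition N0 (c : R) : set 'rV[R[i]]_5 := zeros (PP 4) [set quintic c].

(* The equations z_3 = z_4 = 0 of D_0. *)
Definition D0_eqs : 'I_2 -> {mpoly R[i][5]} :=
  fun i => if i == ord0 then z 3 else z 4.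

Definition N1 (c : R) : set 'rV[R[i]]_(5 + 2) :=
  blowup (PP 4) (N0 c) D0_eqs.

Definition N1_factors : 'I_(5 + 2) -> 'I_(1 + 1) :=
  prod_factors (PP 4) (PP 1).

End Quintic.

(* Main.v *)
Require Import Defs.
From mathcomp Require Import all_boot all_order all_algebra.
From mathcomp Require Import mpoly complex.
From mathcomp Require Import boolp classical_sets reals.
From mathcomp Require Import ring.
Set Implicit Arguments.
Unset Strict Implicit.
Unset Printing Implicit Defensive.
Import Order.TTheory GRing.Theory Num.Theory.
Local Open Scope ring_scope.
Local Open Scope classical_set_scope.

(* M is the complete intersection in P^4 x P^1 x P^1 x P^1 obtained by adjoining
   to z the ratios y = z_3 : z_4, w = z_2 : z_1 and u = B : A, where the quintic
   is z_1 z_4 A = z_2 z_3 B: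
     z_1 w_0 = z_2 w_1,  z_4 y_0 = z_3 y_1,  A u_0 = B u_1,
     w_1 y_1 u_1 = w_0 y_0 u_0.
   A linear dependence between the rows of its Jacobian forces c^5 = 1, so M is
   smooth for c > 1.  N_1 is the complete intersection z_4 y_0 = z_3 y_1,
   z_1 y_1 A = z_2 y_0 B, and M -> N_1 forgets w and u.  It is invertible wherever
   these two ratios can be recovered from (z, y); the remaining points of M lie on
   finitely many rational curves, one over each remaining node.  Density of
   subsets is shown by specializing along one-parameter families, and M is
   projective by the Segre embedding. *)

(** * Multihomogeneous forms and closed sets *)

(** The three ratios come from three surfaces contained in N_0: z_3 = z_4 = 0, z_1 = z_2 = 0 and A =
    B = 0. Writing (z_1, z_2) = t (w_1, w_0), (z_3, z_4) = s (y_0, y_1) and (A, B) = r (u_1, u_0),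
    the quintic becomes t s r (w_1 y_1 u_1 - w_0 y_0 u_0). The fourth equation of M is this with t s
    r removed; without it, the fibre over a node where both w and u are undetermined would be a
    product of two lines. Closures are defined by the vanishing of forms, so both birationality and
    the identification of N_1 ask that a form vanishing off a bad locus vanish on it too.
    Irreducibility of M or N_1 is not established for this. Instead, each point is placed on a curve
    given by a parameter and a root of a monic polynomial over it; monicity permits division with
    remainder, which replaces a limit argument. The bound on chains of irreducible sets is equally
    elementary: along a rational curve a form is a polynomial in one variable, hence zero or with
    finitely many roots. *)

Section Multihomogeneous.
Variables (K : fieldType) (n k : nat) (b : 'I_n -> 'I_k).
Implicit Types (p q : {mpoly K[n]}) (d : 'I_k -> nat) (x y : 'rV[K]_n).
Implicit Types (Z : set 'rV[K]_n).

Lemma pevalD x : {morph (fun p => peval p x) : p q / p + q}.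
Proof. exact: mevalD. Qed.

Lemma pevalB x : {morph (fun p => peval p x) : p q / p - q}.
Proof. exact: mevalB. Qed.

Lemma pevalM x : {morph (fun p => peval p x) : p q / p * q}.
Proof. exact: mevalM. Qed.

Lemma pevalXn m x : {morph (fun p => peval p x) : p / p ^+ m}.
Proof. by move=> p; rewrite /peval rmorphXn. Qed.

Lemma pevalC a x : peval a%:MP x = a.
Proof. exact: mevalC. Qed.

Lemma peval0 x : peval 0 x = 0.
Proof. exact: meval0. Qed.

Lemma peval1 x : peval 1 x = 1.
Proof. exact: meval1. Qed.

Lemma pevalX i x : peval 'X_i x = x ord0 i.
Proof. exact: mevalXU. Qed.

Lemma peval_prod I (r : seq I) P (F : I -> {mpoly K[n]}) x :
  peval (\prod_(i <- r | P i) F i) x = \prod_(i <- r | P i) peval (F i) x.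
Proof. exact: rmorph_prod. Qed.

Lemma eq_mhomog d d' p : d =1 d' -> mhomog b d p -> mhomog b d' p.
Proof. by move=> dd' hp m mp j; rewrite -dd'; exact: hp. Qed.

Lemma mhomog0 d : mhomog b d (0 : {mpoly K[n]}).
Proof. by move=> m; rewrite msupp0. Qed.

Lemma mhomogC a : mhomog b (fun=> 0%N) (a%:MP : {mpoly K[n]}).
Proof.
move=> m; rewrite msuppC; case: ifP => // _; rewrite inE => /eqP -> j.
by apply: big1 => i _; rewrite mnm0E.
Qed.

Lemma mhomog1 : mhomog b (fun=> 0%N) (1 : {mpoly K[n]}).
Proof. by rewrite -mpolyC1; exact: mhomogC. Qed.

Lemma mhomogX i : mhomog b (fun j => (b i == j) : nat) ('X_i : {mpoly K[n]}).
Proof.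
move=> m; rewrite msuppX inE => /eqP -> j.
rewrite (eq_bigr (fun i' => if i' == i then 1%N else 0%N)); last first.
  by move=> i' _; rewrite mnm1E eq_sym; case: eqP.
rewrite -big_mkcondr /=; case: (eqVneq (b i) j) => [<-|bij].
  by rewrite (big_pred1 i) // => i' /=; case: (eqVneq i' i) => [->|_]; rewrite ?eqxx ?andbF.
by rewrite big1 // => i' /andP[/eqP bi'j /eqP i'i]; rewrite -i'i bi'j eqxx in bij.
Qed.

Lemma mhomogD d p q : mhomog b d p -> mhomog b d q -> mhomog b d (p + q).
Proof.
by move=> hp hq m /msuppD_le; rewrite mem_cat => /orP[]; [exact: hp|exact: hq].
Qed.

Lemma mhomogN d p : mhomog b d p -> mhomog b d (- p).
Proof. by move=> hp m; rewrite (perm_mem (msuppN p)); exact: hp. Qed.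

Lemma mhomogB d p q : mhomog b d p -> mhomog b d q -> mhomog b d (p - q).
Proof. by move=> hp hq; apply: mhomogD => //; exact: mhomogN. Qed.

Lemma mhomogM d d' p q : mhomog b d p -> mhomog b d' q ->
  mhomog b (fun j => d j + d' j)%N (p * q).
Proof.
move=> hp hq m /msuppM_le /allpairsP[[m1 m2] /= [/hp m1p /hq m2q ->]] j.
by under eq_bigr do rewrite mnmDE; rewrite big_split /= m1p m2q.
Qed.

Lemma mhomogXn d p e : mhomog b d p -> mhomog b (fun j => e * d j)%N (p ^+ e).
Proof.
move=> hp; elim: e => [|e ih]; first exact: mhomog1.
by rewrite exprS; apply: eq_mhomog (mhomogM hp ih) => j; rewrite mulSn.
Qed.

Lemma mhomog_prod I (r : seq I) (d : I -> 'I_k -> nat) (F : I -> {mpoly K[n]}) :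
  (forall i, mhomog b (d i) (F i)) ->
  mhomog b (fun j => \sum_(i <- r) d i j)%N (\prod_(i <- r) F i).
Proof.
move=> hF; elim: r => [|i r ih].
  by rewrite big_nil; apply: eq_mhomog mhomog1 => j; rewrite big_nil.
by rewrite big_cons; apply: eq_mhomog (mhomogM (hF i) ih) => j; rewrite big_cons.
Qed.

Lemma mhomog_sum (I : eqType) (r : seq I) d (F : I -> {mpoly K[n]}) :
  (forall i, i \in r -> mhomog b d (F i)) -> mhomog b d (\sum_(i <- r) F i).
Proof.
elim: r => [|i r ih] hF; first by rewrite big_nil; exact: mhomog0.
rewrite big_cons; apply: mhomogD; first by apply: hF; rewrite mem_head.
by apply: ih => i' ri'; apply: hF; rewrite inE ri' orbT.
Qed.

Lemma peval_rescale d p (t : 'I_k -> K) x y : mhomog b d p ->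
  (forall i, y ord0 i = t (b i) * x ord0 i) ->
  peval p y = \prod_j t j ^+ d j * peval p x.
Proof.
move=> hp yE; rewrite /peval !mevalE mulr_sumr; apply: eq_big_seq => m mp.
rewrite mulrCA; congr (_ * _); under [LHS]eq_bigr do rewrite yE exprMn.
rewrite big_split /=; congr (_ * _).
rewrite (partition_big b xpredT) //=; apply: eq_bigr => j _.
rewrite -(hp _ mp) -prodrXr; apply: eq_bigr => i /eqP ->; done.
Qed.

Lemma same_point_sym x y : same_point b x y -> same_point b y x.
Proof.
move=> [t t0 yE]; exists (fun j => (t j)^-1) => [j|i]; first by rewrite invr_eq0.
by rewrite yE mulKf.
Qed.

Lemma same_point_refl x : same_point b x x.
Proof. by exists (fun=> 1) => [j|i]; rewrite ?oner_eq0 ?mul1r. Qed.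

Lemma same_point_trans x y w :
  same_point b x y -> same_point b y w -> same_point b x w.
Proof.
move=> [t t0 yE] [s s0 wE]; exists (fun j => s j * t j) => [j|i].
  by rewrite mulf_neq0.
by rewrite wE yE mulrA.
Qed.

Lemma mpoint_same x y : same_point b x y -> mpoint b x -> mpoint b y.
Proof.
move=> [t t0 yE] hx j; have [i bij xi] := hx j; exists i => //.
by rewrite yE mulf_neq0.
Qed.

Lemma peval_same d p x y : mhomog b d p -> same_point b x y ->
  (peval p y == 0) = (peval p x == 0).
Proof.
move=> hp [t t0 yE]; rewrite (peval_rescale hp yE) mulf_eq0.
by rewrite (negbTE (_ : _ != 0)) //; apply/prodf_neq0 => j _; rewrite expf_neq0.
Qed.

Lemma zclosed_mpoint Z x : zclosed b Z -> Z x -> mpoint b x.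
Proof. by case=> S _ -> []. Qed.

Lemma zclosed_same Z x y : zclosed b Z -> same_point b x y -> Z x -> Z y.
Proof.
move=> [S hS ->] xy [xb xS]; split; first exact: mpoint_same xb.
move=> p Sp; have [d hp] := hS p Sp; apply/eqP.
by rewrite (peval_same hp xy) xS.
Qed.

Lemma zclosed_zeros1 d p : mhomog b d p -> zclosed b (zeros b [set p]).
Proof. by move=> hp; exists [set p] => // _ ->; exists d. Qed.

Lemma zclosed0 : zclosed b (@set0 'rV[K]_n).
Proof.
exists [set 1]; first by move=> _ ->; exists (fun=> 0%N); exact: mhomog1.
apply/seteqP; split => // x [_ /(_ 1 erefl)]; rewrite peval1 => /eqP.
by rewrite oner_eq0.
Qed.

Lemma zclosedU (F G : set 'rV[K]_n) : zclosed b F -> zclosed b G -> zclosed b (F `|` G).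
Proof.
move=> [S hS ->] [T hT ->].
exists [set r | exists p q, [/\ S p, T q & r = p * q]].
  move=> _ [p [q [/hS [d hp] /hT [d' hq] ->]]].
  by eexists; exact: mhomogM hp hq.
apply/seteqP; split => x.
  move=> [] [xb h]; split => // _ [p [q [Sp Tq ->]]]; rewrite pevalM.
    by rewrite h ?mul0r.
  by rewrite (h q) ?mulr0.
move=> [xb h]; apply: contrapT => /not_orP[nS nT].
have [p Sp px] : exists2 p, S p & peval p x != 0.
  apply: contrapT => hp; apply: nS; split => // p Sp; apply: contrapT => /eqP px.
  by apply: hp; exists p.
have [q Tq qx] : exists2 q, T q & peval q x != 0.
  apply: contrapT => hp; apply: nT; split => // q Tq; apply: contrapT => /eqP qx.
  by apply: hp; exists q.
have /eqP := h (p * q) (ex_intro _ p (ex_intro _ q (And3 Sp Tq erefl))).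
by rewrite pevalM mulf_eq0 (negbTE px) (negbTE qx).
Qed.

Lemma zclosed_bigU (I : eqType) (r : seq I) (F : I -> set 'rV[K]_n) :
  (forall i, zclosed b (F i)) -> zclosed b [set x | exists2 i, i \in r & F i x].
Proof.
move=> hF; elim: r => [|i r ih].
  by rewrite (_ : mkset _ = set0) ?seteqP; [exact: zclosed0|split => // x [i' //]].
rewrite (_ : mkset _ = F i `|` [set x | exists2 i, i \in r & F i x]).
  exact: zclosedU.
apply/seteqP; split => x.
  move=> [i']; rewrite inE => /predU1P[->|ri'] Fx; first by left.
  by right; exists i'.
move=> [Fx|[i' ri' Fx]]; first by exists i; rewrite ?mem_head.
by exists i'; rewrite // inE ri' orbT.
Qed.

Lemma zirreducible_bigU (I : eqType) (r : seq I) (F : I -> set 'rV[K]_n) Z :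
  (forall i, zclosed b (F i)) -> zirreducible b Z ->
  (forall x, Z x -> exists2 i, i \in r & F i x) ->
  exists2 i, i \in r & Z `<=` F i.
Proof.
move=> hF [[x0 Zx0] irr]; elim: r => [|i r ih] hZ.
  by have [i' //] := hZ _ Zx0.
have [||x Zx|ZF|/ih[i' ri' ZF]] := irr (F i) [set x | exists2 i, i \in r & F i x].
- exact: hF.
- exact: zclosed_bigU.
- have [i'] := hZ x Zx; rewrite inE => /predU1P[->|ri'] Fx; first by left.
  by right; exists i'.
- by exists i; rewrite ?mem_head.
- by exists i'; rewrite // inE ri' orbT.
Qed.

End Multihomogeneous.
Arguments mhomog0 {K n k} b d.
Arguments mhomog1 {K n k} b.
Arguments mhomogC {K n k} b a.
Arguments mhomogX {K n k} b i.
Arguments mhomogXn {K n k b d p} e _.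
Arguments mhomog_prod {K n k b I} r {d F} _.

(** * Unions of rational curves *)

Section Dimension.
Variables (K : fieldType) (n k : nat) (b : 'I_n -> 'I_k).
Implicit Types (x y : 'rV[K]_n).

Definition pclass y : set 'rV[K]_n := [set x | mpoint b x /\ same_point b y x].

(** Proportionality to y in each factor is the vanishing of the 2 by 2 minors of the pair (x, y)
    inside that factor. *)
Lemma zclosed_pclass y : zclosed b (pclass y).
Proof.
have [yb|nyb] := pselect (mpoint b y); last first.
  rewrite (_ : pclass y = set0); first exact: zclosed0.
  by apply/seteqP; split => // x [xb /same_point_sym yx]; apply/nyb/mpoint_same/xb.
exists [set p | exists i i', b i = b i' /\
    p = (y ord0 i')%:MP * 'X_i - (y ord0 i)%:MP * 'X_i'].
  move=> _ [i [i' [bii' ->]]]; exists (fun j => (b i == j) : nat).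
  have hX (c : K) l : b i = b l -> mhomog b (fun j => (b i == j) : nat) (c%:MP * 'X_l).
    move=> ->; apply: eq_mhomog (mhomogM (mhomogC b c) (mhomogX b l)) => j.
    by rewrite add0n.
  by apply: mhomogB; exact: hX.
apply/seteqP; split => x [xb].
  move=> [t t0 xE]; split => // _ [i [i' [bii' ->]]].
  by rewrite pevalB !pevalM !pevalC !pevalX !xE bii'; ring.
move=> h; split => //.
have hyx i i' : b i = b i' -> y ord0 i' * x ord0 i = y ord0 i * x ord0 i'.
  move=> bii'; apply/eqP; rewrite -subr_eq0; apply/eqP.
  have := h _ (ex_intro _ i (ex_intro _ i' (conj bii' erefl))).
  by rewrite pevalB !pevalM !pevalC !pevalX.
have /boolp.choice[f hf] : forall j, exists l, b l = j /\ y ord0 l != 0.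
  by move=> j; have [l] := yb j; exists l.
exists (fun j => x ord0 (f j) / y ord0 (f j)) => [j|i].
  have [bf yf] := hf j; rewrite mulf_neq0 ?invr_eq0 //; apply/eqP => xf.
  have [i bij /negP[]] := xb j; have := hyx i (f j); rewrite bij bf xf mulr0.
  by move=> /(_ erefl)/eqP; rewrite mulf_eq0 (negbTE yf).
have [bf yf] := hf (b i); apply: (mulfI yf).
by rewrite hyx ?bf // mulrA [X in _ = X * _]mulrC divfK // mulrC.
Qed.

(** Points are closed, so irreducibility puts the whole set into one of the finitely many
    classes. *)
Lemma zirreducible_pclasses (Z : set 'rV[K]_n) (r : seq 'rV[K]_n) :
  zirreducible b Z -> (forall x, Z x -> mpoint b x) ->
  (forall x, Z x -> exists2 y, y \in r & same_point b y x) ->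
  forall x y, Z x -> Z y -> same_point b x y.
Proof.
move=> irr Zb Zr x y Zx Zy.
have [|w Zw|q _ hq] := @zirreducible_bigU K n k b _ r pclass Z _ irr.
- exact: zclosed_pclass.
- by have [q rq qw] := Zr w Zw; exists q => //; split => //; exact: Zb.
have [_ qx] := hq _ Zx; have [_ qy] := hq _ Zy.
exact: same_point_trans (same_point_sym qx) qy.
Qed.

Lemma zclosed_in_pclass (E Y Z : set 'rV[K]_n) : zclosed_in b E Y -> Y !=set0 ->
  Z `<=` E -> Y `<=` Z -> (forall x y, Z x -> Z y -> same_point b x y) ->
  Z `<=` Y.
Proof.
move=> [F cF ->] [y [Ey Fy]] ZE YZ hZ x Zx; split; first exact: ZE.
exact: zclosed_same cF (hZ y x (YZ y (conj Ey Fy)) Zx) Fy.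
Qed.

End Dimension.

(** The extra point [q] is the one that a polynomial parametrization of a projective line misses. In
    a chain of three sets, a form separating the upper two is restricted to the curve that contains
    the largest. *)
Lemma zdim_le_rational_curves (K : closedFieldType) n k (b : 'I_n -> 'I_k)
    (E : set 'rV[K]_n) (I : eqType) (r : seq I) (L : I -> set 'rV[K]_n) :
  (forall i, zclosed b (L i)) ->
  (forall x, E x -> exists2 i, i \in r & L i x) ->
  (forall i, exists (g : 'I_n -> {poly K}) (q : 'rV[K]_n), forall x,
     E x -> L i x -> same_point b q x \/
       exists u, same_point b (\row_j (g j).[u]) x) ->
  zdim_le b E 1.
Proof.
move=> cL EL hL [Z [hZ Zlt]].
have [Z0E Z0c [Z0n _]] := hZ 0%N isT.
have [Z1E [F1 [S hS F1E] Z1F] Z1i] := hZ 1%N isT.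
have [Z2E _ Z2i] := hZ 2%N isT.
have [Z01 nZ01] := Zlt 0%N isT.
have [Z12 nZ12] := Zlt 1%N isT.
have [i _ Z2L] := zirreducible_bigU cL Z2i (fun x Zx => EL x (Z2E x Zx)).
have Z2b x : Z 2%N x -> mpoint b x by move=> /Z2L; exact: zclosed_mpoint.
have [x2 Z2x2 nF1x2] : exists2 x, Z 2%N x & ~ F1 x.
  apply: contrapT => h; apply: nZ12 => x Zx; rewrite Z1F; split; first exact: Z2E.
  by apply: contrapT => nF; apply: h; exists x.
have [p Sp px2] : exists2 p, S p & peval p x2 != 0.
  apply: contrapT => h; apply: nF1x2; rewrite F1E; split; first exact: Z2b.
  by move=> p Sp; apply: contrapT => /eqP px; apply: h; exists p.
have pZ1 x : Z 1%N x -> peval p x = 0.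
  by rewrite Z1F F1E => -[_ [_]]; exact.
have [d hp] := hS p Sp.
have [g [q hg]] := hL i.
pose P := mmap polyC g p.
have PE u : P.[u] = peval p (\row_j (g j).[u]).
  rewrite /P /peval mevalE /mmap horner_sum; apply: eq_bigr => m _.
  rewrite hornerM hornerC horner_prod; congr (_ * _); apply: eq_bigr => j _.
  by rewrite horner_exp mxE.
(* If [p] vanishes along the curve, the largest set lies in the union of p = 0 and the point [q]. As
   [p] does not vanish on all of it, it is that point and cannot strictly contain a nonempty closed
   set. *)
have [P0|P0] := eqVneq P 0.
  apply: nZ12; apply: (zclosed_in_pclass (E := E) (b := b)) => //.
  - by exists F1; [exists S|].
  - by case: Z1i.
  have [_ irr] := Z2i.
  have [||x Zx|Zp|Zq x y Zx Zy] := irr (zeros b [set p]) (pclass b q).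
  - exact: zclosed_zeros1 hp.
  - exact: zclosed_pclass.
  - have [qx|[u ux]] := hg x (Z2E x Zx) (Z2L x Zx).
      by right; split => //; exact: Z2b.
    left; split; first exact: Z2b.
    by move=> _ ->; apply/eqP; rewrite (peval_same hp ux) -PE P0 horner0.
  - by move: px2; have [_ /(_ p erefl) ->] := Zp _ Z2x2; rewrite eqxx.
  have [_ qx] := Zq _ Zx; have [_ qy] := Zq _ Zy.
  exact: same_point_trans (same_point_sym qx) qy.
apply: nZ01; apply: (zclosed_in_pclass (b := b) Z0c) => //.
(* Otherwise the middle set consists of [q] and points at the finitely many roots of [P]; being
   irreducible, it is a single point. *)
have [rs Prs] := closed_field_poly_normal P.
apply: (@zirreducible_pclasses _ _ _ _ _
  (q :: [seq \row_j (g j).[u] | u <- rs])) => //.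
  by move=> x /Z12; exact: Z2b.
move=> x Zx; have [qx|[u ux]] := hg x (Z1E x Zx) (Z2L x (Z12 x Zx)).
  by exists q; rewrite ?mem_head.
exists (\row_j (g j).[u]) => //; rewrite inE; apply/orP; right.
apply/mapP; exists u => //; rewrite -root_prod_XsubC.
have : root P u by rewrite rootE PE -(peval_same hp ux) pZ1.
by rewrite Prs rootZ // lead_coef_eq0.
Qed.

(** * The Segre embedding *)

Section Segre.
Variables (K : fieldType) (n k m : nat) (b : 'I_n -> 'I_k).
Variable e : 'I_m.+1 -> {ffun 'I_k -> 'I_n}.
Hypothesis e_surj : forall s, exists l, e l = s.
Hypothesis k_gt0 : (0 < k)%N.
Implicit Types (x : 'rV[K]_n) (T : 'rV[K]_m.+1) (s : {ffun 'I_k -> 'I_n}).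

(* The coordinates of the Segre image are indexed by all maps s from factors to
   coordinates; those which are not sections of b give the zero coordinate. *)
Definition is_section s := [forall j, b (s j) == j].

Definition segre_form (l : 'I_m.+1) : {mpoly K[n]} :=
  if is_section (e l) then \prod_(j <- enum 'I_k) 'X_(e l j) else 0.

Definition segre x : 'rV[K]_m.+1 := \row_l peval (segre_form l) x.

Definition upd s i : {ffun 'I_k -> 'I_n} := [ffun j => if j == b i then i else s j].

Lemma is_section_upd s i : is_section s -> is_section (upd s i).
Proof.
move=> /forallP hs; apply/forallP => j; rewrite ffunE.
by case: (eqVneq j (b i)) => [->|_] //; rewrite eqxx.
Qed.

Lemma idx_exists s : exists l, e l == s.
Proof. by have [l <-] := e_surj s; exists l. Qed.

Definition idx s : 'I_m.+1 := xchoose (idx_exists s).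

Lemma idxK s : e (idx s) = s.
Proof. exact/eqP/(xchooseP (idx_exists s)). Qed.

Lemma segreE x l : segre x ord0 l =
  if is_section (e l) then \prod_j x ord0 (e l j) else 0.
Proof.
rewrite mxE /segre_form; case: ifP => _; last exact: peval0.
by rewrite peval_prod big_enum /=; apply: eq_bigr => j _; rewrite pevalX.
Qed.

(* The inverse of the Segre map where the coordinate of the section s is nonzero. *)
Definition chart s T : 'rV[K]_n := \row_i T ord0 (idx (upd s i)).

(* The relations T_l T_l'^(k-1) = prod_j T_(l' with its j-th entry taken from l)
   suffice to cut out the image. *)
Definition segre_rel : set {mpoly K[m.+1]} :=
  [set p | (exists2 l, ~~ is_section (e l) & p = 'X_l) \/
     exists l l', [/\ is_section (e l), is_section (e l') &
       p = 'X_l * 'X_l' ^+ k.-1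
           - \prod_(j <- enum 'I_k) 'X_(idx (upd (e l') (e l j)))]].

(** The product in front of x_i depends on i only through [b i], so the chart returns x up to a
    rescaling of each factor. *)
Lemma segre_chart s x : is_section s ->
  forall i, chart s (segre x) ord0 i =
    \prod_(j | j != b i) x ord0 (s j) * x ord0 i.
Proof.
move=> hs i; rewrite mxE segreE idxK is_section_upd // (bigD1 (b i)) //=.
rewrite mulrC ffunE eqxx; congr (_ * _); apply: eq_bigr => j /negbTE ji.
by rewrite ffunE ji.
Qed.

(** This is the relation of [segre_rel] with [l'] the index of [s]: its product is exactly the Segre
    coordinate of the chart. *)
Lemma chart_segre T s : (forall p, segre_rel p -> peval p T = 0) ->
  is_section s ->
  forall l, segre (chart s T) ord0 l = T ord0 (idx s) ^+ k.-1 * T ord0 l.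
Proof.
move=> hT hs l; rewrite segreE; case: ifP => hl; last first.
  have := hT 'X_l; rewrite pevalX => ->; first by rewrite mulr0.
  by left; exists l; rewrite ?hl.
have := hT _ (or_intror (ex_intro _ l (ex_intro _ (idx s) (And3 _ _ erefl)))).
rewrite idxK => /(_ hl hs); rewrite pevalB pevalM pevalXn !pevalX peval_prod.
move=> /eqP; rewrite subr_eq0 => /eqP; rewrite mulrC => ->.
rewrite big_enum /=; apply: eq_bigr => j _; rewrite mxE pevalX.
by congr (T _ (idx (upd _ _))); rewrite ?idxK.
Qed.

Lemma segre_relP x p : segre_rel p -> peval p (segre x) = 0.
Proof.
case=> [[l hl ->]|[l [l' [hl hl' ->]]]].
  by rewrite pevalX segreE (negbTE hl).
rewrite pevalB pevalM pevalXn !pevalX peval_prod big_enum /=.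
under eq_bigr do rewrite pevalX.
apply/eqP; rewrite subr_eq0; apply/eqP.
transitivity (\prod_j (x ord0 (e l j) * \prod_(j' | j' != j) x ord0 (e l' j'))).
  rewrite big_split /= !segreE hl hl'; congr (_ * _).
  under [RHS]eq_bigr do rewrite big_mkcond.
  rewrite exchange_big /= -prodrXl; apply: eq_bigr => j _.
  rewrite (bigD1 j) //= eqxx mul1r (eq_bigr (fun=> x ord0 (e l' j))).
    by rewrite prodr_const (cardC1 j) card_ord.
  by move=> i /negbTE; rewrite eq_sym => ->.
apply: eq_bigr => j _.
have := segre_chart x hl' (e l j); rewrite mxE => ->.
by move/forallP: hl => /(_ j)/eqP ->; rewrite mulrC.
Qed.

(** Substitution of the chart coordinates into [p], expanded over the monomials of [p] so that the
    degree can be read off. *)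
Definition segre_pull s (p : {mpoly K[n]}) : {mpoly K[m.+1]} :=
  \sum_(mm <- msupp p)
     (p@_mm)%:MP * \prod_(i <- enum 'I_n) 'X_(idx (upd s i)) ^+ mm i.

Lemma peval_segre_pull s p T : peval (segre_pull s p) T = peval p (chart s T).
Proof.
rewrite /segre_pull /peval raddf_sum mevalE; apply: eq_bigr => mm _ /=.
rewrite mevalM mevalC; congr (_ * _); rewrite rmorph_prod big_enum /=.
by apply: eq_bigr => i _; rewrite rmorphXn /= mevalXU mxE.
Qed.

Lemma mhomog_PP_X l : mhomog (PP m) (fun=> 1%N) ('X_l : {mpoly K[m.+1]}).
Proof. by apply: eq_mhomog (mhomogX _ l) => j; rewrite [PP m l]ord1 [j]ord1. Qed.

Arguments mhomog_PP_X l : clear implicits.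

Lemma mhomog_segre_pull d s p : mhomog b d p ->
  mhomog (PP m) (fun=> \sum_j d j)%N (segre_pull s p).
Proof.
move=> hp; apply: mhomog_sum => mm mp.
have hX i := mhomogXn (mm i) (mhomog_PP_X (idx (upd s i))).
apply: eq_mhomog (mhomogM (mhomogC _ _) (mhomog_prod (enum 'I_n) hX)) => _ /=.
rewrite add0n big_enum /= (partition_big b xpredT) //=.
by apply: eq_bigr => j _; rewrite -(hp mm mp j); apply: eq_bigr => i _; rewrite muln1.
Qed.

Lemma mhomog_segre_rel p : segre_rel p -> exists d, mhomog (PP m) d p.
Proof.
case=> [[l _ ->]|[l [l' [_ _ ->]]]]; first by eexists; exact: mhomog_PP_X.
exists (fun=> k); apply: mhomogB.
  apply: eq_mhomog (mhomogM (mhomog_PP_X l) (mhomogXn k.-1 (mhomog_PP_X l'))).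
  by move=> _; rewrite muln1 add1n prednK.
apply: eq_mhomog (mhomog_prod (enum 'I_k) (fun j => mhomog_PP_X _)) => _.
by rewrite big_enum /= sum1_card card_ord.
Qed.

Lemma mhomog_segre_form l : mhomog b (fun=> 1%N) (segre_form l).
Proof.
rewrite /segre_form; case: ifP => [/forallP hl|_]; last exact: mhomog0.
apply: eq_mhomog (mhomog_prod (enum 'I_k) (fun j => mhomogX b (e l j))) => j.
rewrite big_enum /= (bigD1 j) //= (eqP (hl j)) eqxx big1 // => j' j'j.
by rewrite (eqP (hl j')) (negbTE j'j).
Qed.

Lemma same_point_rescale x y (t : 'I_k -> K) : mpoint b y ->
  (forall i, y ord0 i = t (b i) * x ord0 i) -> same_point b x y.
Proof.
move=> yb yE; exists t => // j; have [i' <-] := yb j.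
by rewrite yE mulf_eq0 negb_or => /andP[].
Qed.

Lemma mpoint_segre x : mpoint b x -> mpoint (PP m) (segre x).
Proof.
move=> xb; have /boolp.choice[f hf] : forall j, exists l, b l = j /\ x ord0 l != 0.
  by move=> j; have [l] := xb j; exists l.
move=> j; exists (idx (finfun f)); first by rewrite [LHS]ord1 [j]ord1.
rewrite segreE idxK (_ : is_section _); last first.
  by apply/forallP => j'; rewrite ffunE; have [->] := hf j'.
by apply/prodf_neq0 => j' _; rewrite ffunE; have [_] := hf j'.
Qed.

(** The equations are pulled back through every chart, since a single chart inverts the Segre map
    only where its own coordinate is nonzero. *)
Definition segre_image (S : set {mpoly K[n]}) : set 'rV[K]_m.+1 :=
  zeros (PP m) [set q | segre_rel q \/
    exists s p, [/\ is_section s, S p & q = segre_pull s p]].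

(** The default [e ord0] is never met on the image, whose points have a nonzero coordinate. *)
Definition pick_section T : {ffun 'I_k -> 'I_n} :=
  if [pick l | T ord0 l != 0] is Some l then e l else e ord0.

Definition segre_inv T := chart (pick_section T) T.

Section Image.
Variable S : set {mpoly K[n]}.
Hypothesis S_homog : forall p, S p -> exists d, mhomog b d p.

Lemma segre_image_rel T p : segre_image S T -> segre_rel p -> peval p T = 0.
Proof. by move=> [_ hT] hp; apply: hT; left. Qed.

Lemma pick_sectionP T : segre_image S T ->
  is_section (pick_section T) /\ T ord0 (idx (pick_section T)) != 0.
Proof.
move=> hT; rewrite /pick_section; case: pickP => [l Tl|T0]; last first.
  by have [/(_ ord0)[l _ Tl]] := hT; have := T0 l; rewrite /= Tl.
have hl : is_section (e l).
  apply/negPn/negP => nl; move: Tl; rewrite -(pevalX l T).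
  by rewrite (@segre_image_rel _ 'X_l hT) ?eqxx //; left; exists l.
split=> //; have el j : upd (e l) (e l j) = e l.
  apply/ffunP => j'; rewrite ffunE (eqP (forallP hl j)).
  by case: (eqVneq j' j) => [->|].
(* As [e] may repeat values, [l] and [idx (e l)] can differ; the relation with l' = l compares the
   k-th powers of their coordinates. *)
have /eqP := segre_image_rel hT (or_intror (ex_intro _ l (ex_intro _ l
  (And3 hl hl erefl)))).
rewrite pevalB pevalM pevalXn !pevalX -exprS prednK // peval_prod big_enum /=.
under eq_bigr do rewrite pevalX el.
rewrite prodr_const card_ord subr_eq0 => /eqP Tk.
by have := expf_neq0 k Tl; rewrite Tk expf_eq0 k_gt0.
Qed.

Lemma chart_segre_image T s : segre_image S T -> is_section s ->
  T ord0 (idx s) != 0 -> zeros b S (chart s T).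
Proof.
move=> hT hs Ts; split.
  move=> j; exists (s j); first exact/eqP/(forallP hs).
  rewrite mxE (_ : upd s (s j) = s) //.
  apply/ffunP => j'; rewrite ffunE (eqP (forallP hs j)).
  by case: (eqVneq j' j) => [->|].
move=> p Sp; rewrite -peval_segre_pull; case: hT => _; apply; right.
by exists s, p.
Qed.

Lemma segre_in_image x : zeros b S x -> segre_image S (segre x).
Proof.
move=> [xb xS]; split; first exact: mpoint_segre.
move=> q [|[s [p [hs Sp ->]]]]; first exact: segre_relP.
have [d hp] := S_homog Sp; rewrite peval_segre_pull.
have -> := peval_rescale (t := fun j => \prod_(j' | j' != j) x ord0 (s j')) hp
  (segre_chart x hs).
by rewrite xS ?mulr0.
Qed.

(** Since [segre_inv] picks its section anew at each T, regularity requires the forms of one fixed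
    chart to represent it wherever they have a point as value. *)
Lemma segre_inv_same T s : segre_image S T -> is_section s ->
  mpoint b (chart s T) -> same_point b (chart s T) (segre_inv T).
Proof.
move=> hT hs Tsb; have [hs' Ts'] := pick_sectionP hT.
have relT p := @segre_image_rel T p hT.
set s' := pick_section T in hs' Ts'.
apply: same_point_sym; rewrite /segre_inv -/s'.
apply: (@same_point_rescale _ _ (fun j => (T ord0 (idx s') ^+ k.-1)^-1 *
   \prod_(j' | j' != j) (chart s' T) ord0 (s j'))) => // i.
rewrite -mulrA -segre_chart // ![chart s _ _ _]mxE (chart_segre relT hs').
by rewrite mulKf // expf_neq0.
Qed.

Lemma segre_isomorphism :
  isomorphism b (PP m) (zeros b S) (segre_image S) segre.
Proof.
split; first split.
- exact: segre_in_image.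
- move=> x [xb xS]; exists segre_form => /=; split.
  + by exists (fun _ _ => 1%N) => l; exact: mhomog_segre_form.
  + exact: mpoint_segre.
  + by move=> y _ _; exact: same_point_refl.
exists segre_inv; split; first split.
- move=> T hT; have [hs Ts] := pick_sectionP hT; exact: chart_segre_image.
- move=> T hT; have [hs Ts] := pick_sectionP hT.
  exists (fun i => 'X_(idx (upd (pick_section T) i))) => /=.
  have rowE T' : \row_i peval ('X_(idx (upd (pick_section T) i))) T' =
      chart (pick_section T) T'.
    by apply/rowP => i; rewrite !mxE pevalX.
  split; first by exists (fun _ _ => 1%N) => i; exact: mhomog_PP_X.
  + by rewrite rowE; have [] := chart_segre_image hT hs Ts.
  + by move=> T' hT'; rewrite rowE => T'b; exact: segre_inv_same.
- move=> x hx; have hT := segre_in_image hx; have [hs Ts] := pick_sectionP hT.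
  have [Tb _] := chart_segre_image hT hs Ts; apply: same_point_sym.
  apply: (@same_point_rescale _ _
    (fun j => \prod_(j' | j' != j) x ord0 (pick_section (segre x) j'))) => //.
  exact: segre_chart.
- move=> T hT; have [hs Ts] := pick_sectionP hT.
  have relT p := @segre_image_rel T p hT; apply: same_point_sym.
  exists (fun=> T ord0 (idx (pick_section T)) ^+ k.-1) => [_|l].
    exact: expf_neq0.
  exact: chart_segre.
Qed.

End Image.
End Segre.

Lemma zclosed_projective (K : fieldType) n k (b : 'I_n -> 'I_k)
    (X : set 'rV[K]_n) : (0 < k)%N -> zclosed b X -> projective b X.
Proof.
move=> k0 [S hS ->].
(* Without coordinates the product has no point, because one of its k > 0 factors would need a
   nonzero coordinate; then X is empty. *)
have [n0|n0] := posnP n.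
  exists 0%N, set0, (fun=> 0); split; first exact: zclosed0.
  have X0 x : ~ zeros b S x.
    by subst n => -[/(_ (Ordinal k0))[[]]].
  split; first by split=> x hx; case: (X0 x).
  by exists (fun=> 0); split=> [|x hx|//]; [split|case: (X0 x)].
pose F := {ffun 'I_k -> 'I_n}.
have F0 : (0 < #|F|)%N by rewrite card_ffun !card_ord expn_gt0 n0.
pose e (l : 'I_(#|F|.-1.+1)) : F := enum_val (cast_ord (prednK F0) l).
have e_surj s : exists l, e l = s.
  exists (cast_ord (esym (prednK F0)) (enum_rank s)).
  by rewrite /e cast_ordKV enum_rankK.
exists #|F|.-1, (segre_image b e_surj S), (segre b e).
split; last exact: segre_isomorphism.
exists [set q | segre_rel b e_surj q \/
    exists s p, [/\ is_section b s, S p & q = segre_pull b e_surj s p]] => //.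
move=> q [|[s [p [_ Sp ->]]]]; first exact: mhomog_segre_rel.
by have [d hp] := hS p Sp; eexists; apply: mhomog_segre_pull hp.
Qed.

(** * Specialization along one-parameter families *)

Section Specialization.
Variable K : numClosedFieldType.
Implicit Types (P Q : {poly {poly K}}) (D : {poly K}).

Lemma poly_all_roots0 (p : {poly K}) : (forall s, p.[s] = 0) -> p = 0.
Proof.
move=> p0; apply/eqP/negPn/negP => pn0.
have := @max_poly_roots _ p [seq j%:R | j <- iota 0 (size p)] pn0.
rewrite size_map size_iota ltnn => h; apply/notF/h.
  by apply/allP => _ /mapP[j _ ->]; rewrite rootE p0.
by rewrite map_inj_uniq ?iota_uniq // => j j' /eqP; rewrite eqr_nat => /eqP.
Qed.

(** A one-variable Nullstellensatz: [q] is up to a scalar a product of deg q linear factors, each of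
    which divides [p]. *)
Lemma dvdp_exp_of_roots (p q : {poly K}) : q != 0 ->
  (forall v, root q v -> root p v) -> q %| p ^+ (size q).-1.
Proof.
move=> q0 qp; have [rs qE] := closed_field_poly_normal q.
have -> : (size q).-1 = size rs.
  by rewrite qE size_scale ?lead_coef_eq0 // size_prod_XsubC.
rewrite qE dvdpZl ?lead_coef_eq0 //.
have {qp} : all (root p) rs.
  apply/allP => r rrs; apply: qp.
  by rewrite qE rootZ ?lead_coef_eq0 // root_prod_XsubC.
elim: rs {qE} => [|r rs ih] /=; first by rewrite big_nil dvd1p.
move=> /andP[pr /ih prs]; rewrite big_cons exprS; apply: dvdp_mul => //.
by rewrite dvdp_XsubCl.
Qed.

(** In K[s][v] the outer variable is v, so [P.[v%:P].[s]] is the value P(s, v). *)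
Lemma horner_map_eval P s v : (map_poly (horner_eval s) P).[v] = P.[v%:P].[s].
Proof.
by rewrite -[v in LHS](hornerC v s) -[X in _.[X]]/(horner_eval s _) horner_map.
Qed.

(* At every s with D(s) <> 0 the power of P with exponent deg Q is divisible by
   Q, so its remainder modulo the monic Q vanishes at these s, hence identically. *)
Lemma monic_specialization P Q D : Q \is monic -> D != 0 ->
  (forall s v, D.[s] != 0 -> Q.[v%:P].[s] = 0 -> P.[v%:P].[s] = 0) ->
  forall s v, Q.[v%:P].[s] = 0 -> P.[v%:P].[s] = 0.
Proof.
move=> Qm D0 hPQ.
pose at_ s : {rmorphism {poly {poly K}} -> {poly K}} := map_poly (horner_eval s).
have atE p s v : (at_ s p).[v] = p.[v%:P].[s] by exact: horner_map_eval.
have Qs s : at_ s Q \is monic by exact: monic_map.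
have sizeQs s : size (at_ s Q) = size Q.
  by rewrite size_map_poly_id0 // (monicP Qm) /= /horner_eval hornerC oner_eq0.
pose e := (size Q).-1; pose r := P ^+ e %% Q.
have PE : P ^+ e = P ^+ e %/ Q * Q + r by exact: Pdiv.IdomainMonic.divp_eq.
have dvdP s : D.[s] != 0 -> at_ s Q %| at_ s P ^+ e.
  move=> Ds; rewrite /e -(sizeQs s); apply: dvdp_exp_of_roots.
    exact: monic_neq0.
  by move=> v; rewrite !rootE !atE => /eqP Q0; rewrite hPQ.
have atr s : D.[s] != 0 -> at_ s r = 0.
  move=> Ds; apply/eqP/negPn/negP => r0.
  have : at_ s Q %| at_ s r.
    by have := dvdP s Ds; rewrite -rmorphXn PE rmorphD rmorphM dvdp_addr // dvdp_mull.
  move=> /(dvdp_leq r0); rewrite sizeQs leqNgt.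
  by rewrite (leq_ltn_trans (size_poly _ _)) // ltn_modp monic_neq0.
have r0 : r = 0.
  apply/polyP => l; rewrite coef0; apply: (mulfI D0); rewrite mulr0.
  apply: poly_all_roots0 => s; rewrite hornerM.
  have [->|Ds] := eqVneq D.[s] 0; first by rewrite mul0r.
  have := congr1 (fun p : {poly K} => p`_l) (atr s Ds).
  by rewrite /at_ coef_map /= /horner_eval coef0 => ->; rewrite mulr0.
move=> s v Q0; have := congr1 (fun p => (at_ s p).[v]) PE.
rewrite r0 addr0 rmorphM rmorphXn hornerM horner_exp !atE Q0 mulr0 => /eqP.
by rewrite expf_eq0 => /andP[_ /eqP].
Qed.

(** Monicity of [Q] in v prevents roots from escaping to infinity at the zeros of [D], so every
    point there is a limit of good ones. Such a limit may vanish in a factor, whence the condition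
    [mpoint]. *)
Lemma zclosed_specialization n k (b : 'I_n -> 'I_k) (F : set 'rV[K]_n)
    (g : 'I_n -> {poly {poly K}}) Q D :
  let x s v : 'rV[K]_n := \row_i (g i).[v%:P].[s] in
  zclosed b F -> Q \is monic -> D != 0 ->
  (forall s v, D.[s] != 0 -> Q.[v%:P].[s] = 0 -> F (x s v)) ->
  forall s v, Q.[v%:P].[s] = 0 -> mpoint b (x s v) -> F (x s v).
Proof.
move=> x [S _ ->] Qm D0 hF s v Q0 xb; split => // p Sp.
pose P := mmap (polyC \o polyC) g p.
have PE s' v' : P.[v'%:P].[s'] = peval p (x s' v').
  rewrite /P /peval mevalE /mmap !horner_sum; apply: eq_bigr => m _.
  rewrite !hornerM !hornerC !horner_prod; congr (_ * _).
  by apply: eq_bigr => i _; rewrite !horner_exp mxE.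
rewrite -PE; apply: monic_specialization Qm D0 _ _ _ Q0 => s' v' Ds' Q0'.
by rewrite PE; have [_] := hF s' v' Ds' Q0'; exact.
Qed.
End Specialization.

(** * The equations of M and N_1 *)

Definition nz2 (K : fieldType) (a b : K) := (a != 0) || (b != 0).

Section Algebra.
Variable K : numClosedFieldType.

(** Certificates for ideal membership: each use supplies the cofactors and leaves a polynomial or
    rational identity. *)
Lemma lincomb1 (a b c d q : K) : c = d -> a - b = q * (c - d) -> a = b.
Proof. by move=> -> /eqP; rewrite subrr mulr0 subr_eq0 => /eqP. Qed.

Lemma lincomb2 (a b c d c' d' q q' : K) : c = d -> c' = d' ->
  a - b = q * (c - d) + q' * (c' - d') -> a = b.
Proof. by move=> -> -> /eqP; rewrite !subrr !mulr0 addr0 subr_eq0 => /eqP. Qed.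

Lemma nz2_cancel (a b l : K) : nz2 a b -> l * a = 0 -> l * b = 0 -> l = 0.
Proof.
by case/orP => h /eqP + /eqP; rewrite !mulf_eq0 (negbTE h) ?orbF => /eqP + /eqP.
Qed.

Lemma nz2_proportional (p0 p1 q0 q1 : K) : nz2 p0 p1 -> nz2 q0 q1 ->
  p0 * q1 = p1 * q0 -> exists2 t, t != 0 & q0 = t * p0 /\ q1 = t * p1.
Proof.
move=> hp hq h; case/orP: hp => p_neq0.
  have q1E : q1 = q0 / p0 * p1 by apply: (mulfI p_neq0); rewrite h; field.
  exists (q0 / p0); last by split => //; rewrite divfK.
  apply/eqP => t0; move: hq; rewrite /nz2 q1E t0 mul0r eqxx orbF.
  by rewrite -(divfK p_neq0 q0) t0 mul0r eqxx.
have q0E : q0 = q1 / p1 * p0 by apply: (mulfI p_neq0); rewrite -h; field.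
exists (q1 / p1); last by split => //; rewrite divfK.
apply/eqP => t0; move: hq; rewrite /nz2 q0E t0 mul0r eqxx /=.
by rewrite -(divfK p_neq0 q1) t0 mul0r eqxx.
Qed.

Lemma nz2_multiple (p0 p1 q0 q1 : K) : nz2 p0 p1 ->
  p0 * q1 = p1 * q0 -> exists t, q0 = t * p0 /\ q1 = t * p1.
Proof.
move=> hp h; have [hq|] := boolP (nz2 q0 q1).
  by have [t _ ?] := nz2_proportional hp hq h; exists t.
by rewrite negb_or !negbK => /andP[/eqP -> /eqP ->]; exists 0; rewrite !mul0r.
Qed.

(** * Rank of the Jacobian of M *)

Section Jacobian.
(** The case z_0 = 0. The four vanishing products kill z_1, z_4 and u_1, and then l_1 and l_2; what
    is left is a finite check of which coordinates vanish. *)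
Lemma jacobian_at_infinity (z1 z2 z3 z4 y0 y1 w0 w1 u0 u1 l1 l2 l3 l4 : K) :
  l3 != 0 -> u0 != 0 -> nz2 w0 w1 -> nz2 y0 y1 ->
  [|| z1 != 0, z2 != 0, z3 != 0 | z4 != 0] ->
  z1 ^+ 3 * u0 = 0 -> z2 ^+ 3 * u1 = 0 ->
  z3 ^+ 3 * u1 = 0 -> z4 ^+ 3 * u0 = 0 ->
  z1 * w0 = z2 * w1 -> z4 * y0 = z3 * y1 -> w1 * y1 * u1 = w0 * y0 * u0 ->
  l1 * w0 = l3 * (3 * z1 ^+ 2 * u0) -> l1 * w1 = l3 * (3 * z2 ^+ 2 * u1) ->
  l2 * y1 = l3 * (3 * z3 ^+ 2 * u1) -> l2 * y0 = l3 * (3 * z4 ^+ 2 * u0) ->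
  l1 * z1 = l4 * (y0 * u0) -> l2 * z4 = l4 * (w0 * u0) ->
  l3 * (z2 ^+ 3 + z3 ^+ 3) = - (l4 * (w1 * y1)) -> False.
Proof.
move=> l30 u00 hw hy hz k1 k2 k3 k4 e1 e2 e4 c1 c2 c3 c4 c5 c7 c10.
have zu (z u : K) : z ^+ 3 * u = 0 -> (z == 0) || (u == 0).
  by move=> /eqP; rewrite mulf_eq0 expf_eq0.
have z10 : z1 = 0 by have := zu _ _ k1; rewrite (negbTE u00) orbF => /eqP.
have z40 : z4 = 0 by have := zu _ _ k4; rewrite (negbTE u00) orbF => /eqP.
subst z1 z4; move: hz; rewrite eqxx orbF /= => hz.
have u10 : u1 = 0.
  apply/eqP; move: hz (zu _ _ k2) (zu _ _ k3).
  by case: (z2 == 0); case: (z3 == 0); case: (u1 == 0).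
subst u1; rewrite !(expr0n, mulr0, mul0r) /= in e1 e2 e4 c1 c2 c3 c4 c5 c7.
have l10 : l1 = 0 by exact: nz2_cancel hw c1 c2.
have l20 : l2 = 0 by exact: nz2_cancel hy c4 c3.
have B0 (a b c : K) : 0 = a * (b * c) -> c != 0 -> (a == 0) || (b == 0).
  by move=> /esym/eqP + c0; rewrite !mulf_eq0 (negbTE c0) orbF.
have := B0 _ _ _ c5 u00; have := B0 _ _ _ c7 u00.
have wy : (w0 == 0) || (y0 == 0).
  by move/esym/eqP: e4; rewrite !mulf_eq0 (negbTE u00) orbF.
move/esym/eqP: e1; rewrite mulf_eq0; move/esym/eqP: e2; rewrite mulf_eq0.
(* For l_4 nonzero, y_0 = w_0 = 0, which forces z_2 = z_3 = 0. For l_4 = 0, z_2^3 + z_3^3 = 0 makes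
   both nonzero, so w_1 = y_1 = 0, against w_0 y_0 = 0. *)
have [l40|] := eqVneq l4 0; last first.
  move: hz hw hy; rewrite /nz2.
  by case: (z2 == 0); case: (z3 == 0); case: (y0 == 0); case: (y1 == 0);
     case: (w0 == 0); case: (w1 == 0).
have : (z2 == 0) = (z3 == 0).
  move/eqP: c10; rewrite l40 mul0r oppr0 mulf_eq0 (negbTE l30) /= addr_eq0 => /eqP h.
  by have := congr1 (fun t => t == 0) h; rewrite oppr_eq0 !expf_eq0.
move: hz hw hy wy; rewrite /nz2.
by case: (z2 == 0); case: (z3 == 0); case: (y0 == 0); case: (y1 == 0);
     case: (w0 == 0); case: (w1 == 0).
Qed.

Variables (C : K) (z0 z1 z2 z3 z4 y0 y1 w0 w1 u0 u1 l1 l2 l3 l4 : K).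

Let A := z0 ^+ 3 - z1 ^+ 3 - z4 ^+ 3.
Let B := C * z0 ^+ 3 - z2 ^+ 3 - z3 ^+ 3.

(** After the equations of M come the columns, for z, w, y and u in this order, of a vanishing
    combination of the rows. Multiplying a column by its own coordinate makes them comparable: the
    equations identify l_1 w_0 z_1 with l_1 w_1 z_2 and l_2 y_1 z_3 with l_2 y_0 z_4, and l_4 w_0
    y_0 u_0 links the two pairs. *)
Lemma jacobian_row_free :
  C ^+ 5 != 1 -> C != 0 ->
  [|| z0 != 0, z1 != 0, z2 != 0, z3 != 0 | z4 != 0] ->
  nz2 y0 y1 -> nz2 w0 w1 -> nz2 u0 u1 ->
  z1 * w0 = z2 * w1 -> z4 * y0 = z3 * y1 -> A * u0 = B * u1 ->
  w1 * y1 * u1 = w0 * y0 * u0 ->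
  l3 * (3 * z0 ^+ 2 * u0 - C * 3 * z0 ^+ 2 * u1) = 0 ->
  l1 * w0 = l3 * (3 * z1 ^+ 2 * u0) -> l1 * w1 = l3 * (3 * z2 ^+ 2 * u1) ->
  l2 * y1 = l3 * (3 * z3 ^+ 2 * u1) -> l2 * y0 = l3 * (3 * z4 ^+ 2 * u0) ->
  l1 * z1 = l4 * (y0 * u0) -> l1 * z2 = l4 * (y1 * u1) ->
  l2 * z4 = l4 * (w0 * u0) -> l2 * z3 = l4 * (w1 * u1) ->
  l3 * A = l4 * (w0 * y0) -> l3 * B = l4 * (w1 * y1) ->
  [/\ l1 = 0, l2 = 0, l3 = 0 & l4 = 0].
Proof.
move=> C5 C0 hz hy hw hu e1 e2 e3 e4 c0 c1 c2 c3 c4 c5 c6 c7 c8 c9 c10.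
have [l30|l30] := eqVneq l3 0.
  rewrite l30 !mul0r in c1 c2 c3 c4 c9 c10.
  have l10 : l1 = 0 by exact: nz2_cancel hw c1 c2.
  have l20 : l2 = 0 by exact: nz2_cancel hy c4 c3.
  split => //; apply/eqP/negPn/negP => l40.
  (* The pairwise products of w_0, y_0, u_0 vanish, and so do those of w_1, y_1, u_1. Each triple
     thus has two zeros, and four zeros among three pairs fill one pair. *)
  have cancel (a b : K) : 0 = l4 * (a * b) -> (a == 0) || (b == 0).
    by move=> /esym/eqP; rewrite mulf_eq0 (negbTE l40) mulf_eq0.
  rewrite l10 l20 !mul0r in c5 c6 c7 c8.
  move: (cancel _ _ c5) (cancel _ _ c6) (cancel _ _ c7) (cancel _ _ c8) (cancel _ _ c9) (cancel _ _ c10).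
  move: hy hw hu; rewrite /nz2.
  by case: (y0 == 0); case: (y1 == 0); case: (w0 == 0); case: (w1 == 0); case: (u0 == 0); case: (u1 == 0).
exfalso.
have l33 : l3 * 3 != 0 by rewrite mulf_neq0 // pnatr_eq0.
have c2' : l1 * w1 * z2 = l3 * 3 * (z2 ^+ 3 * u1) by rewrite c2; ring.
have c1' : l1 * w0 * z1 = l3 * 3 * (z1 ^+ 3 * u0) by rewrite c1; ring.
have c3' : l2 * y1 * z3 = l3 * 3 * (z3 ^+ 3 * u1) by rewrite c3; ring.
have c4' : l2 * y0 * z4 = l3 * 3 * (z4 ^+ 3 * u0) by rewrite c4; ring.
(* All four of z_1^3 u_0, z_2^3 u_1, z_3^3 u_1, z_4^3 u_0 equal k, and
   z_0^3 u_0 = C z_0^3 u_1 = 5 k; for k <> 0 the quintic then gives C^5 = 1. *)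
pose k := z1 ^+ 3 * u0.
have k2 : z2 ^+ 3 * u1 = k.
  by apply: (mulfI l33); rewrite /k -c1' -c2'; apply: (lincomb1 (q := - l1) e1); ring.
have k4 : z4 ^+ 3 * u0 = k.
  apply: (mulfI l33); rewrite /k -c1' -c4'.
  by apply: (lincomb2 (q := - w0) (q' := y0) c5 c7); ring.
have k3 : z3 ^+ 3 * u1 = k.
  by rewrite -k4; apply: (mulfI l33); rewrite -c3' -c4'; apply: (lincomb1 (q := - l2) e2); ring.
have kA : l4 * (w0 * y0) * u0 = l3 * (3 * k).
  transitivity (l3 * 3 * (z1 ^+ 3 * u0)); last by rewrite /k; ring.
  by rewrite -c1'; apply: (lincomb1 (q := - w0) c5); ring.
have Au0 : A * u0 = 3 * k by apply: (mulfI l30); rewrite -kA -c9; ring.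
have Bu1 : B * u1 = 3 * k by rewrite -e3.
have z0u0 : z0 ^+ 3 * u0 = 5 * k.
  by transitivity (A * u0 + (z1 ^+ 3 * u0 + z4 ^+ 3 * u0)); [rewrite /A; ring|rewrite Au0 k4 -/k; ring].
have z0u1 : C * z0 ^+ 3 * u1 = 5 * k.
  by transitivity (B * u1 + (z2 ^+ 3 * u1 + z3 ^+ 3 * u1)); [rewrite /B; ring|rewrite Bu1 k2 k3; ring].
have five0 : (5 : K) != 0 by rewrite pnatr_eq0.
have [k0|kn0] := eqVneq k 0; last first.
  have u00 : u0 != 0 by apply: contraNneq kn0 => u00; rewrite /k u00 mulr0.
  have u10 : u1 != 0 by apply: contraNneq kn0 => u10; rewrite -k2 u10 mulr0.
  have wy0 : w0 * y0 != 0.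
    apply: contraNneq kn0 => wy; apply/eqP; apply: (mulfI l33).
    by rewrite -mulrA -kA wy !(mul0r, mulr0).
  have z1E : z0 ^+ 3 = 5 * z1 ^+ 3 by apply: (mulIf u00); rewrite z0u0 /k mulrA.
  have z4E : z4 ^+ 3 = z1 ^+ 3 by apply: (mulIf u00); rewrite k4.
  have z3E : z3 ^+ 3 = z2 ^+ 3 by apply: (mulIf u10); rewrite k3 k2.
  have z2E : z2 ^+ 3 = C * z1 ^+ 3.
    by apply: (mulIf u10); apply: (mulfI five0); rewrite k2 -z0u1 z1E; ring.
  have AE : A = 3 * z1 ^+ 3 by rewrite /A z1E z4E; ring.
  have BE : B = 3 * (C * z1 ^+ 3) by rewrite /B z1E z3E z2E; ring.
  have wAB : A * (w1 * y1) = B * (w0 * y0).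
    apply: (mulIf u10); transitivity (A * (w1 * y1 * u1)); first by ring.
    by rewrite e4; transitivity (A * u0 * (w0 * y0)); [ring|rewrite e3; ring].
  have eqz : z1 * z4 * A = z2 * z3 * B.
    apply: (mulIf wy0); transitivity (z1 * w0 * (z4 * y0) * A); first by ring.
    rewrite e1 e2; transitivity (z2 * z3 * (A * (w1 * y1))); first by ring.
    by rewrite wAB; ring.
  have z10 : z1 ^+ 3 != 0 by apply: contraNneq kn0; rewrite /k => ->; rewrite mul0r.
  (* Cubing the quintic leaves only cubes of the z_i, all multiples of z_1^3: the two sides are 27
     (z_1^3)^5 and 27 C^5 (z_1^3)^5. *)
  have := congr1 (fun t => t ^+ 3) eqz; rewrite !exprMn AE BE z4E z3E z2E => h.
  move/eqP: C5; apply.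
  have h0 : 27 * (z1 ^+ 3) ^+ 5 != 0 by rewrite mulf_neq0 ?(expf_neq0 5 z10) ?pnatr_eq0.
  by apply: (mulIf h0); apply: (lincomb1 (q := -1) h); ring.
have z00 : z0 = 0.
  rewrite k0 mulr0 in z0u0 z0u1; case/orP: hu => u_neq0.
    by move/eqP: z0u0; rewrite mulf_eq0 (negbTE u_neq0) orbF expf_eq0 => /eqP.
  move/eqP: z0u1; rewrite -mulrA mulf_eq0 (negbTE C0) mulf_eq0 (negbTE u_neq0).
  by rewrite orbF expf_eq0 => /eqP.
rewrite k0 in k2 k3 k4; have k1 : z1 ^+ 3 * u0 = 0 by [].
have nzC (a b : K) : nz2 a b -> nz2 b a by rewrite /nz2 orbC.
move: hz; rewrite z00 eqxx /= => hz.
case/orP: hu => [u00|u10].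
  apply: (jacobian_at_infinity l30 u00 hw hy hz k1 k2 k3 k4 e1 e2 e4 c1 c2 c3 c4 c5 c7).
  by rewrite -c10 /B z00; ring.
(* The mirror case: the equations at z_0 = 0 are symmetric under exchanging z_1 with z_2, z_3 with
   z_4, and the two entries of each of w, y and u. *)
have hz' : [|| z2 != 0, z1 != 0, z4 != 0 | z3 != 0].
  by move: hz; do 4!case: (_ != 0).
apply: (jacobian_at_infinity l30 u10 (nzC _ _ hw) (nzC _ _ hy) hz' k2 k1 k4 k3
  (esym e1) (esym e2) (esym e4) c2 c1 c4 c3 c6 c8).
by rewrite -c9 /A z00; ring.
Qed.

End Jacobian.
End Algebra.

(** Generic in the ring [T], so that one expression serves both for forms and for their values. *)
Definition cubicA (T : comNzRingType) (v : nat -> T) : T :=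
  v 0 ^+ 3 - v 1 ^+ 3 - v 4 ^+ 3.

Definition cubicB (T : comNzRingType) (c : T) (v : nat -> T) : T :=
  c * v 0 ^+ 3 - v 2 ^+ 3 - v 3 ^+ 3.

(** * The remaining nodes of N_1 and the recovery of w and u *)

Section Nodes.
Variables (K : numClosedFieldType) (C : K).
Hypothesis C0 : C != 0.
Implicit Types v : nat -> K.

(* In a coordinate function v, indices 0-4 stand for z, 5-6 for y, 7-8 for w and
   9-10 for u. *)
Definition nz5 v := [|| v 0 != 0, v 1 != 0, v 2 != 0, v 3 != 0 | v 4 != 0].

Definition eqN v :=
  v 4 * v 5 = v 3 * v 6 /\ v 1 * v 6 * cubicA v = v 2 * v 5 * cubicB C v.

Definition eqM v :=
  [/\ v 1 * v 7 = v 2 * v 8, v 4 * v 5 = v 3 * v 6,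
      cubicA v * v 9 = cubicB C v * v 10
    & v 8 * v 6 * v 10 = v 7 * v 5 * v 9].

(* The points of N_1 over which w and u are not both determined. *)
Definition nodal v :=
  [/\ v 1 = 0, v 2 = 0, v 6 * cubicA v = 0 & v 5 * cubicB C v = 0] \/
  [/\ cubicA v = 0, cubicB C v = 0, v 1 * v 6 = 0 & v 2 * v 5 = 0].

(** With z_0 nonzero the cases contain 3, 3, 9, 9 and 9 points: the 33 nodes off D_0, the blow-up
    having dealt with the 16 nodes on it. *)
Inductive node_position v : Prop :=
| Node_A of v 1 = 0 & v 2 = 0 & v 6 = 0 & v 4 = 0 & v 3 ^+ 3 = C * v 0 ^+ 3
| Node_B of v 1 = 0 & v 2 = 0 & v 5 = 0 & v 3 = 0 & v 4 ^+ 3 = v 0 ^+ 3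
| Node_AB of v 1 = 0 & v 2 = 0 & v 4 ^+ 3 = v 0 ^+ 3 & v 3 ^+ 3 = C * v 0 ^+ 3
| Node_2 of v 2 = 0 & v 6 = 0 & v 4 = 0 & v 1 ^+ 3 = v 0 ^+ 3 &
    v 3 ^+ 3 = C * v 0 ^+ 3
| Node_1 of v 1 = 0 & v 5 = 0 & v 3 = 0 & v 4 ^+ 3 = v 0 ^+ 3 &
    v 2 ^+ 3 = C * v 0 ^+ 3.

Lemma nodal_position v : v 4 * v 5 = v 3 * v 6 -> nz2 (v 5) (v 6) -> nodal v ->
  node_position v.
Proof.
move=> e hy hn.
have m0 (a b : K) : a * b = 0 -> a != 0 -> b = 0.
  by move=> /eqP + a0; rewrite mulf_eq0 (negbTE a0) => /eqP.
have m0' (a b : K) : a * b = 0 -> b != 0 -> a = 0 by rewrite mulrC; exact: m0.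
have AE : cubicA v = 0 -> v 4 ^+ 3 = v 0 ^+ 3 - v 1 ^+ 3.
  by rewrite /cubicA => A0; apply: (lincomb1 (q := -1) A0); ring.
have BE : cubicB C v = 0 -> v 3 ^+ 3 = C * v 0 ^+ 3 - v 2 ^+ 3.
  by rewrite /cubicB => B0; apply: (lincomb1 (q := -1) B0); ring.
have z3 : (0 : K) ^+ 3 = 0 by rewrite expr0n.
have [v60|v60] := eqVneq (v 6) 0.
  have v50 : v 5 != 0 by move: hy; rewrite /nz2 v60 eqxx orbF.
  have v40 : v 4 = 0 by apply: m0' v50; rewrite e v60 mulr0.
  case: hn => [[v1 v2 _ /m0/(_ v50)/BE]|[/AE A0 /BE B0 _ /m0'/(_ v50) v2]].
    by rewrite v2 z3 subr0 => ?; apply: Node_A.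
  apply: Node_2 => //; last by rewrite B0 v2 z3 subr0.
  by move/eqP: A0; rewrite v40 z3 eq_sym subr_eq0 => /eqP.
have [v50|v50] := eqVneq (v 5) 0.
  have v30 : v 3 = 0 by apply: m0' v60; rewrite -e v50 mulr0.
  case: hn => [[v1 v2 /m0/(_ v60)/AE + _]|[/AE A0 /BE B0 /m0'/(_ v60) v1 _]].
    by rewrite v1 z3 subr0 => ?; apply: Node_B.
  apply: Node_1 => //; first by rewrite A0 v1 z3 subr0.
  by move/eqP: B0; rewrite v30 z3 eq_sym subr_eq0 => /eqP ->.
case: hn => [[v1 v2 /m0/(_ v60)/AE + /m0/(_ v50)/BE]|].
  by rewrite v1 v2 z3 !subr0 => ? ?; apply: Node_AB.
move=> [/AE + /BE + /m0'/(_ v60) v1 /m0'/(_ v50) v2].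
by rewrite v1 v2 z3 !subr0 => ? ?; apply: Node_AB.
Qed.

Lemma cube0 (a b : K) : a ^+ 3 = b -> b = 0 -> a = 0.
Proof. by move=> <- /eqP; rewrite expf_eq0 => /eqP. Qed.

Lemma node_z0 v : nz5 v -> node_position v -> v 0 != 0.
Proof.
move=> hz hn; apply/negP => /eqP v0; move: hz; rewrite /nz5 v0 eqxx.
have z3 : v 0 ^+ 3 = 0 by rewrite v0 expr0n.
have Cz3 : C * v 0 ^+ 3 = 0 by rewrite z3 mulr0.
by case: hn => [-> -> _ -> /cube0/(_ Cz3) ->|-> -> _ -> /cube0/(_ z3) ->
  |-> -> /cube0/(_ z3) -> /cube0/(_ Cz3) ->
  |-> _ -> /cube0/(_ z3) -> /cube0/(_ Cz3) ->
  |-> _ -> /cube0/(_ z3) -> /cube0/(_ Cz3) ->]; rewrite eqxx.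
Qed.

(** Over a remaining node, y is therefore determined by z. *)
Lemma node_z34 v : v 0 != 0 -> node_position v -> nz2 (v 3) (v 4).
Proof.
move=> v0; have c0 (a : K) b : a ^+ 3 = b -> b != 0 -> a != 0.
  by move=> <-; rewrite expf_eq0.
have z3 : v 0 ^+ 3 != 0 by rewrite expf_neq0.
have Cz3 : C * v 0 ^+ 3 != 0 by rewrite mulf_neq0.
rewrite /nz2; case=> *; apply/orP;
  by [left; exact: c0 Cz3 | right; exact: c0 z3].
Qed.

(** All the ratios z_i / z_0 are roots of one polynomial, which gives finiteness of the nodes
    without listing them. *)
Lemma node_cubes v i : node_position v -> (0 < i < 5)%N ->
  v i * (v i ^+ 3 - v 0 ^+ 3) * (v i ^+ 3 - C * v 0 ^+ 3) = 0.
Proof.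
by move=> hn; case: i => [|[|[|[|[|//]]]]] // _; case: hn => *;
  do ?[match goal with
  | h : v ?i = 0 |- context [v ?i] => rewrite h
  | h : v ?i ^+ 3 = _ |- context [v ?i ^+ 3] => rewrite h
  end]; rewrite ?subrr ?mul0r ?mulr0 ?mul0r.
Qed.

(** In these terms the second equation of N_1 is t r times the fourth equation of M. *)
Lemma eqM_multiples v : nz2 (v 7) (v 8) -> nz2 (v 9) (v 10) -> eqM v ->
  exists t r, [/\ v 1 = t * v 8, v 2 = t * v 7, cubicA v = r * v 10
    & cubicB C v = r * v 9].
Proof.
rewrite /nz2 orbC => hw; rewrite orbC => hu [e1 _ e3 _].
have [|t [v1 v2]] := nz2_multiple hw (_ : v 8 * v 2 = v 7 * v 1).
  by rewrite mulrC -e1 mulrC.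
have [|r [A B]] := nz2_multiple hu (_ : v 10 * cubicB C v = v 9 * cubicA v).
  by rewrite mulrC -e3 mulrC.
by exists t, r.
Qed.

Lemma eqM_eqN v : nz2 (v 7) (v 8) -> nz2 (v 9) (v 10) -> eqM v -> eqN v.
Proof.
move=> hw hu hM; have [t [r [v1 v2 A B]]] := eqM_multiples hw hu hM.
have [_ e2 _ e4] := hM; split => //; rewrite A B v1 v2.
by apply: (lincomb1 (q := t * r) e4); ring.
Qed.

(** On N_1 the ratio w_0 : w_1 is z_2 : z_1 and also y_1 A : y_0 B; likewise u_0 : u_1 is B : A and
    also z_1 y_1 : z_2 y_0. Both expressions for one ratio vanish exactly in one of the alternatives
    of [nodal]. *)
Definition ratio_w (T : comNzRingType) (c : T) (b : bool) (v : nat -> T) : T * T :=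
  if b then (v 2, v 1) else (v 6 * cubicA v, v 5 * cubicB c v).

Definition ratio_u (T : comNzRingType) (c : T) (b : bool) (v : nat -> T) : T * T :=
  if b then (cubicB c v, cubicA v) else (v 1 * v 6, v 2 * v 5).

Definition lift_coords (T : comNzRingType) (c : T) (b b' : bool) (v : nat -> T) (i : nat) : T :=
  match i with
  | 7 => (ratio_w c b v).1 | 8 => (ratio_w c b v).2
  | 9 => (ratio_u c b' v).1 | 10 => (ratio_u c b' v).2
  | _ => v i
  end.

Definition lift_w v := nz2 (v 2) (v 1).
Definition lift_u v := nz2 (cubicB C v) (cubicA v).

Lemma nz2F (a b : K) : nz2 a b = false -> a = 0 /\ b = 0.
Proof. by move/negbT; rewrite negb_or !negbK => /andP[/eqP -> /eqP ->]. Qed.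

Lemma lift_w_neq0 v : ~ nodal v ->
  nz2 (ratio_w C (lift_w v) v).1 (ratio_w C (lift_w v) v).2.
Proof.
rewrite /lift_w; case: (boolP (nz2 (v 2) (v 1))) => // /negbTE/nz2F[v2 v1].
by apply: contra_notT => /negbTE/nz2F[]; left.
Qed.

Lemma lift_u_neq0 v : ~ nodal v ->
  nz2 (ratio_u C (lift_u v) v).1 (ratio_u C (lift_u v) v).2.
Proof.
rewrite /lift_u; case: (boolP (nz2 (cubicB C v) (cubicA v))) => // /negbTE/nz2F[B A].
by apply: contra_notT => /negbTE/nz2F[]; right.
Qed.

Lemma lift_eqM v : eqN v -> ~ nodal v -> eqM (lift_coords C (lift_w v) (lift_u v) v).
Proof.
move=> [e1 e2] hn; set v' := lift_coords _ _ _ _.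
have [A' B'] : cubicA v' = cubicA v /\ cubicB C v' = cubicB C v by [].
rewrite /eqM A' B' /v' /lift_w /lift_u /= {v' A' B'}.
case: (boolP (nz2 (v 2) (v 1))) => [_|/negbTE/nz2F[v2 v1]];
  case: (boolP (nz2 (cubicB C v) (cubicA v))) => [_|/negbTE/nz2F[B A]] /=.
- by split=> //; ring.
- by split=> //; [ring|rewrite A B !mul0r|ring].
- by split=> //; [rewrite v1 v2 !mul0r|ring|ring].
(* Here z_1 = z_2 = A = B = 0, a nodal point. *)
by case: hn; left; rewrite A B !mulr0.
Qed.

Lemma eqM_ratio_w v b : nz2 (v 7) (v 8) -> nz2 (v 9) (v 10) -> eqM v ->
  v 7 * (ratio_w C b v).2 = v 8 * (ratio_w C b v).1.
Proof.
move=> hw hu hM; have [t [r [v1 v2 A B]]] := eqM_multiples hw hu hM.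
have [_ _ _ e4] := hM; case: b => /=; first by rewrite v1 v2; ring.
by rewrite A B; apply: (lincomb1 (q := - r) e4); ring.
Qed.

Lemma eqM_ratio_u v b : nz2 (v 7) (v 8) -> nz2 (v 9) (v 10) -> eqM v ->
  v 9 * (ratio_u C b v).2 = v 10 * (ratio_u C b v).1.
Proof.
move=> hw hu hM; have [t [r [v1 v2 A B]]] := eqM_multiples hw hu hM.
have [_ _ _ e4] := hM; case: b => /=; first by rewrite A B; ring.
by rewrite v1 v2; apply: (lincomb1 (q := - t) e4); ring.
Qed.

End Nodes.

(** * The varieties M and N_1 *)

Definition hcoord (K : fieldType) n (x : 'rV[K]_n.+1) (i : nat) : K := x ord0 (inord i).

Definition vec (K : fieldType) n (v : nat -> K) : 'rV[K]_n := \row_(i < n) v i.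

Definition var (K : fieldType) n (i : nat) : {mpoly K[n.+1]} := 'X_(inord i).

Lemma hcoord_vec (K : fieldType) n (v : nat -> K) i : (i <= n)%N ->
  hcoord (vec n.+1 v) i = v i.
Proof. by move=> i_le; rewrite /hcoord mxE inordK. Qed.

Lemma vec_hcoord (K : fieldType) n (x : 'rV[K]_n.+1) : vec n.+1 (hcoord x) = x.
Proof. by apply/rowP => i; rewrite mxE /hcoord inord_val. Qed.

Lemma peval_var (K : fieldType) n (x : 'rV[K]_n.+1) i : peval (var K n i) x = hcoord x i.
Proof. exact: pevalX. Qed.

Lemma forall_inord n (P : 'I_n.+1 -> Prop) :
  (forall i, (i <= n)%N -> P (inord i)) -> forall i, P i.
Proof. by move=> h i; rewrite -(inord_val i); apply: h; rewrite -ltnS. Qed.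

Definition eqM_forms (T : comNzRingType) (c : T) (v : nat -> T) : seq T :=
  [:: v 1 * v 7 - v 2 * v 8; v 4 * v 5 - v 3 * v 6;
      cubicA v * v 9 - cubicB c v * v 10; v 8 * v 6 * v 10 - v 7 * v 5 * v 9].

Definition eqN_forms (T : comNzRingType) (c : T) (v : nat -> T) : seq T :=
  [:: v 4 * v 5 - v 3 * v 6; v 1 * v 6 * cubicA v - v 2 * v 5 * cubicB c v].

Definition nodal_forms (T : comNzRingType) (c : T) (v : nat -> T) (b : bool) : seq T :=
  if b then [:: v 1; v 2; v 6 * cubicA v; v 5 * cubicB c v]
  else [:: cubicA v; cubicB c v; v 1 * v 6; v 2 * v 5].

(** * Points and forms in coordinates *)

Section Coordinates.
Variable K : numClosedFieldType.

Definition factor (i : nat) : nat :=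
  if (i < 5)%N then 0 else if (i < 7)%N then 1 else if (i < 9)%N then 2 else 3.

Definition M_factors (i : 'I_11) : 'I_4 := inord (factor i).

Lemma factor_lt4 i : (factor i < 4)%N.
Proof. by rewrite /factor; do 3!case: ifP => // _. Qed.

Lemma val_M_factors i : (i < 11)%N -> val (M_factors (inord i)) = factor i.
Proof. by move=> i11; rewrite /M_factors /= (inordK i11) (inordK (factor_lt4 i)). Qed.

Lemma val_N1_factors i : (i < 7)%N ->
  val (N1_factors (inord i : 'I_7)) = factor i.
Proof.
move=> i7; rewrite /N1_factors /prod_factors; case: splitP => j /=.
  by rewrite (inordK i7) => ->; rewrite /factor ltn_ord.
rewrite (inordK i7) => iE; rewrite iE in i7 *.
by case: j i7 {iE} => [[|[|]]].
Qed.

Lemma mpoint_M (x : 'rV[K]_11) : mpoint M_factors x <->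
  [/\ nz5 (hcoord x), nz2 (hcoord x 5) (hcoord x 6), nz2 (hcoord x 7) (hcoord x 8)
    & nz2 (hcoord x 9) (hcoord x 10)].
Proof.
split=> [hx|[hz hy hw hu]].
  have hj j : (j < 4)%N -> exists2 i, (i < 11)%N && (factor i == j) & hcoord x i != 0.
    move=> j4; have [i bij xi] := hx (Ordinal j4); exists (val i).
      by rewrite ltn_ord /= -val_M_factors // inord_val bij.
    by rewrite /hcoord inord_val.
  rewrite /nz5 /nz2; split.
  - have [l] := hj 0%N isT.
    by do 11?[case: l => [|l] //]; move=> _ ->; rewrite ?orbT.
  - have [l] := hj 1%N isT.
    by do 11?[case: l => [|l] //]; move=> _ ->; rewrite ?orbT.
  - have [l] := hj 2%N isT.
    by do 11?[case: l => [|l] //]; move=> _ ->; rewrite ?orbT.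
  - have [l] := hj 3%N isT.
    by do 11?[case: l => [|l] //]; move=> _ ->; rewrite ?orbT.
have hi i j : (i < 11)%N -> factor i = val j -> hcoord x i != 0 ->
    exists2 i, M_factors i = j & x ord0 i != 0.
  move=> i11 ij xi; exists (inord i) => //.
  by apply: val_inj; rewrite -ij; exact: val_M_factors.
move=> j; case: j (hi) => [[|[|[|[|//]]]] hj] {}hi.
- by move: hz; do ?[case/orP => [h|]]; [| | | | move=> h]; exact: (hi _ _ _ _ h).
- by case/orP: hy => h; exact: (hi _ _ _ _ h).
- by case/orP: hw => h; exact: (hi _ _ _ _ h).
- by case/orP: hu => h; exact: (hi _ _ _ _ h).
Qed.
Lemma mpoint_N1 (x : 'rV[K]_(5 + 2)) : mpoint N1_factors x <->
  nz5 (hcoord x) /\ nz2 (hcoord x 5) (hcoord x 6).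
Proof.
split=> [hx|[hz hy]].
  have hj j : (j < 2)%N -> exists2 i, (i < 7)%N && (factor i == j) & hcoord x i != 0.
    move=> j2; have [i bij xi] := hx (Ordinal j2); exists (val i).
      by rewrite ltn_ord /= -val_N1_factors // inord_val bij.
    by rewrite /hcoord inord_val.
  rewrite /nz5 /nz2; split.
  - have [l] := hj 0%N isT.
    by do 11?[case: l => [|l] //]; move=> _ ->; rewrite ?orbT.
  - have [l] := hj 1%N isT.
    by do 11?[case: l => [|l] //]; move=> _ ->; rewrite ?orbT.
have hi i j : (i < 7)%N -> factor i = val j -> hcoord x i != 0 ->
    exists2 i, N1_factors i = j & x ord0 i != 0.
  move=> i7 ij xi; exists (inord i) => //.
  by apply: val_inj; rewrite -ij; exact: val_N1_factors.
move=> j; case: j (hi) => [[|[|//]] hj] {}hi.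
- by move: hz; do ?[case/orP => [h|]]; [| | | | move=> h]; exact: (hi _ _ _ _ h).
- by case/orP: hy => h; exact: (hi _ _ _ _ h).
Qed.

(** * Gradings shared by the ambient spaces of M and N_1 *)

Section Graded.
Variables (n k : nat) (b : 'I_n.+1 -> 'I_k).
Hypothesis b_factor : forall i, (i < n.+1)%N -> val (b (inord i)) = factor i.

Lemma same_point_factor (x y : 'rV[K]_n.+1) (t : nat -> K) :
  (forall j, t j != 0) ->
  (forall i, (i <= n)%N -> hcoord y i = t (factor i) * hcoord x i) ->
  same_point b x y.
Proof.
move=> t0 yE; exists (fun j => t (val j)) => [j|]; first exact: t0.
by apply: forall_inord => i i_le; rewrite b_factor //; exact: yE.
Qed.

Lemma mhomog_var i : (i <= n)%N ->
  mhomog b (fun j => (factor i == val j) : nat) (var K n i).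
Proof.
by move=> i_le; apply: eq_mhomog (mhomogX b _) => j; rewrite -val_eqE b_factor.
Qed.

Hypothesis n_ge4 : (4 <= n)%N.

Lemma mhomog_cubicA : mhomog b (fun j => 3 * (0 == val j))%N (cubicA (var K n)).
Proof.
have h i : (i < 5)%N -> mhomog b (fun j => 3 * (0 == val j))%N (var K n i ^+ 3).
  move=> i5; have i_le : (i <= n)%N by exact: leq_trans n_ge4.
  by apply: eq_mhomog (mhomogXn 3 (mhomog_var i_le)) => j; rewrite /factor i5.
by apply: mhomogB; [apply: mhomogB|]; exact: h.
Qed.

Lemma mhomog_cubicB c :
  mhomog b (fun j => 3 * (0 == val j))%N (cubicB c%:MP (var K n)).
Proof.
have h i : (i < 5)%N -> mhomog b (fun j => 3 * (0 == val j))%N (var K n i ^+ 3).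
  move=> i5; have i_le : (i <= n)%N by exact: leq_trans n_ge4.
  by apply: eq_mhomog (mhomogXn 3 (mhomog_var i_le)) => j; rewrite /factor i5.
apply: mhomogB; [apply: mhomogB|]; [|exact: h|exact: h].
exact: eq_mhomog (mhomogM (mhomogC b c) (h 0%N isT)).
Qed.

Arguments mhomog_cubicB c : clear implicits.

Lemma peval_cubicA (x : 'rV[K]_n.+1) : peval (cubicA (var K n)) x = cubicA (hcoord x).
Proof. by rewrite /cubicA !pevalB !pevalXn !peval_var. Qed.

Lemma peval_cubicB c (x : 'rV[K]_n.+1) :
  peval (cubicB c%:MP (var K n)) x = cubicB c (hcoord x).
Proof. by rewrite /cubicB !pevalB pevalM pevalC !pevalXn !peval_var. Qed.

Lemma zclosed_zeros_seq (s : seq {mpoly K[n.+1]}) :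
  (forall p, p \in s -> exists d, mhomog b d p) ->
  zclosed b (zeros b [set p | p \in s]).
Proof. by move=> hs; exists [set p | p \in s]. Qed.

Lemma zeros_seqP (s : seq {mpoly K[n.+1]}) x :
  zeros b [set p | p \in s] x <-> mpoint b x /\ all (fun p => peval p x == 0) s.
Proof.
split=> -[xb h]; split=> //; first by apply/allP => p /h ->.
by move=> p /(allP h)/eqP.
Qed.

Hypothesis n_ge6 : (6 <= n)%N.

Lemma mhomog_eqN c p : p \in eqN_forms c%:MP (var K n) -> exists d, mhomog b d p.
Proof.
have hX i : (i <= 6)%N -> mhomog b (fun j => (factor i == val j) : nat) (var K n i).
  by move=> i6; apply: mhomog_var; exact: leq_trans n_ge6.
rewrite !inE => /orP[] /eqP ->.
  exists (fun j => ((0 == val j) + (1 == val j))%N); apply: mhomogB.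
    exact: eq_mhomog (mhomogM (hX 4 isT) (hX 5 isT)).
  exact: eq_mhomog (mhomogM (hX 3 isT) (hX 6 isT)).
exists (fun j => ((0 == val j) + (1 == val j) + 3 * (0 == val j))%N); apply: mhomogB.
  exact: eq_mhomog (mhomogM (mhomogM (hX 1 isT) (hX 6 isT)) mhomog_cubicA).
exact: eq_mhomog (mhomogM (mhomogM (hX 2 isT) (hX 5 isT)) (mhomog_cubicB c)).
Qed.

Lemma mhomog_ratio_w c e : exists d, mhomog b d (ratio_w c%:MP e (var K n)).1 /\
  mhomog b d (ratio_w c%:MP e (var K n)).2.
Proof.
have hX i : (i <= 6)%N -> mhomog b (fun j => (factor i == val j) : nat) (var K n i).
  by move=> i6; apply: mhomog_var; exact: leq_trans n_ge6.
case: e => /=; first by exists (fun j => (0 == val j) : nat); split; [exact: (hX 2 isT)|exact: (hX 1 isT)].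
exists (fun j => ((1 == val j) + 3 * (0 == val j))%N); split.
  exact: eq_mhomog (mhomogM (hX 6 isT) mhomog_cubicA).
exact: eq_mhomog (mhomogM (hX 5 isT) (mhomog_cubicB c)).
Qed.

Lemma mhomog_ratio_u c e : exists d, mhomog b d (ratio_u c%:MP e (var K n)).1 /\
  mhomog b d (ratio_u c%:MP e (var K n)).2.
Proof.
have hX i : (i <= 6)%N -> mhomog b (fun j => (factor i == val j) : nat) (var K n i).
  by move=> i6; apply: mhomog_var; exact: leq_trans n_ge6.
case: e => /=.
  exists (fun j => 3 * (0 == val j))%N; split; first exact: mhomog_cubicB.
  exact: mhomog_cubicA.
exists (fun j => ((0 == val j) + (1 == val j))%N); split.
  exact: eq_mhomog (mhomogM (hX 1 isT) (hX 6 isT)).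
exact: eq_mhomog (mhomogM (hX 2 isT) (hX 5 isT)).
Qed.

Lemma mhomog_nodal c e p : p \in nodal_forms c%:MP (var K n) e ->
  exists d, mhomog b d p.
Proof.
have hX i : (i <= 6)%N -> mhomog b (fun j => (factor i == val j) : nat) (var K n i).
  by move=> i6; apply: mhomog_var; exact: leq_trans n_ge6.
have [dw [w1 w2]] := mhomog_ratio_w c false.
have [du [u1 u2]] := mhomog_ratio_u c false.
rewrite /nodal_forms; case: e; rewrite !inE => /or4P[] /eqP ->.
- by eexists; exact: (hX 1 isT).
- by eexists; exact: (hX 2 isT).
- by exists dw.
- by exists dw.
- by eexists; exact: mhomog_cubicA.
- by eexists; exact: mhomog_cubicB.
- by exists du.
- by exists du.
Qed.

Definition nodal_set c : set 'rV[K]_n.+1 :=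
  zeros b [set p | p \in nodal_forms c%:MP (var K n) true] `|`
  zeros b [set p | p \in nodal_forms c%:MP (var K n) false].

Lemma zclosed_nodal_set c : zclosed b (nodal_set c).
Proof. by apply: zclosedU; apply: zclosed_zeros_seq => p; exact: mhomog_nodal. Qed.

Lemma nodal_setP c x : nodal_set c x <-> mpoint b x /\ nodal c (hcoord x).
Proof.
rewrite /nodal_set /= !zeros_seqP /=.
rewrite !pevalM !peval_cubicA !peval_cubicB !peval_var !andbT.
split=> [[[xb /and4P[/eqP ? /eqP ? /eqP ? /eqP ?]]|[xb /and4P[/eqP ? /eqP ? /eqP ? /eqP ?]]]|].
- by split => //; left.
- by split => //; right.
by move=> [xb [[-> -> -> ->]|[-> -> -> ->]]]; [left|right]; rewrite !eqxx.
Qed.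

Lemma zeros_eqN c x : zeros b [set p | p \in eqN_forms c%:MP (var K n)] x <->
  mpoint b x /\ eqN c (hcoord x).
Proof.
rewrite zeros_seqP /= !pevalB !pevalM !peval_cubicA !peval_cubicB !peval_var.
rewrite !subr_eq0 andbT.
by split=> [[xb /andP[/eqP ? /eqP ?]]|[xb [-> ->]]]; rewrite ?eqxx.
Qed.

Lemma zeros_eqM c x : zeros b [set p | p \in eqM_forms c%:MP (var K n)] x <->
  mpoint b x /\ eqM c (hcoord x).
Proof.
rewrite zeros_seqP /= !pevalB !pevalM !peval_cubicA !peval_cubicB !peval_var.
rewrite !subr_eq0 andbT.
by split=> [[xb /and4P[/eqP ? /eqP ? /eqP ? /eqP ?]]|[xb [-> -> -> ->]]]; rewrite ?eqxx.
Qed.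

End Graded.
Arguments mhomog_var {n k b} b_factor {i} _.
Arguments mhomog_cubicA {n k b} b_factor _.
Arguments mhomog_cubicB {n k b} b_factor _ c.
Arguments mhomog_ratio_w {n k b} b_factor _ _ c e.
Arguments mhomog_ratio_u {n k b} b_factor _ _ c e.

Section Equations.
Variable C : K.

Definition Mvar : set 'rV[K]_11 :=
  zeros M_factors [set p | p \in eqM_forms C%:MP (var K 10)].

Let hM := val_M_factors.

Lemma mhomog_eqM p : p \in eqM_forms C%:MP (var K 10) ->
  exists d, mhomog M_factors d p.
Proof.
have hA := mhomog_cubicA hM isT; have hB := mhomog_cubicB hM isT C.
have hX i : (i <= 10)%N -> _ := fun i_le => mhomog_var hM i_le.
rewrite !inE => /or4P[] /eqP ->.
- exists (fun j => ((0 == val j) + (2 == val j))%N); apply: mhomogB.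
  + exact: eq_mhomog (mhomogM (hX 1 isT) (hX 7 isT)).
  + exact: eq_mhomog (mhomogM (hX 2 isT) (hX 8 isT)).
- exists (fun j => ((0 == val j) + (1 == val j))%N); apply: mhomogB.
  + exact: eq_mhomog (mhomogM (hX 4 isT) (hX 5 isT)).
  + exact: eq_mhomog (mhomogM (hX 3 isT) (hX 6 isT)).
- exists (fun j => (3 * (0 == val j) + (3 == val j))%N); apply: mhomogB.
  + exact: eq_mhomog (mhomogM hA (hX 9 isT)).
  + exact: eq_mhomog (mhomogM hB (hX 10 isT)).
exists (fun j => ((2 == val j) + (1 == val j) + (3 == val j))%N); apply: mhomogB.
  exact: eq_mhomog (mhomogM (mhomogM (hX 8 isT) (hX 6 isT)) (hX 10 isT)).
exact: eq_mhomog (mhomogM (mhomogM (hX 7 isT) (hX 5 isT)) (hX 9 isT)).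
Qed.
Definition Nvar : set 'rV[K]_(5 + 2) :=
  zeros N1_factors [set p | p \in eqN_forms C%:MP (var K 6)].

Lemma zclosed_Mvar : zclosed M_factors Mvar.
Proof. by apply: zclosed_zeros_seq; exact: mhomog_eqM. Qed.

Lemma zclosed_Nvar : zclosed N1_factors Nvar.
Proof.
apply: (@zclosed_zeros_seq 6) => p; apply: (@mhomog_eqN 6) => //.
exact: val_N1_factors.
Qed.

Lemma MvarP x : Mvar x <-> mpoint M_factors x /\ eqM C (hcoord x).
Proof. exact: zeros_eqM. Qed.

Lemma NvarP x : Nvar x <-> mpoint N1_factors x /\ eqN C (hcoord x).
Proof. exact: (@zeros_eqN 6). Qed.

End Equations.
End Coordinates.

Lemma monicXnD (T : nzRingType) d (q : {poly T}) : (size q <= d)%N ->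
  'X^d + q \is monic.
Proof. by move=> qd; rewrite monicE lead_coefDl ?size_polyXn // lead_coefXn. Qed.

Lemma cubic_neq0 (T : idomainType) (a b : T) : a != 0 \/ b != 0 ->
  a%:P * 'X^3 - b%:P != 0.
Proof.
move=> ab; apply/eqP => q0; have := congr1 (fun q : {poly T} => q`_3) q0.
have := congr1 (fun q : {poly T} => q`_0) q0.
rewrite !coefB !coefCM !coefXn !coefC /= mulr0 mulr1 sub0r subr0 ?coef0.
by move=> /eqP; rewrite oppr_eq0 => /eqP b0 a0; case: ab; rewrite ?a0 ?b0 eqxx.
Qed.

Definition hevalE := (hornerXn, hornerD, hornerN, hornerM, hornerX, hornerC).

(** * Density of the non-nodal points *)

Section Density.
Variables (K : numClosedFieldType) (C : K).
Hypothesis C0 : C != 0.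

Definition vec_poly n (g : nat -> {poly {poly K}}) (s r : K) : 'rV[K]_n :=
  vec n (fun i => (g i).[r%:P].[s]).

Lemma zclosed_curve n k (b : 'I_n -> 'I_k) (F : set 'rV[K]_n) g
    (Q : {poly {poly K}}) (D : {poly K}) :
  zclosed b F -> Q \is monic -> D != 0 ->
  (forall s r, D.[s] != 0 -> Q.[r%:P].[s] = 0 -> F (vec_poly n g s r)) ->
  forall s r, Q.[r%:P].[s] = 0 -> mpoint b (vec_poly n g s r) ->
  F (vec_poly n g s r).
Proof.
move=> cF Qm D0 hF; exact: (zclosed_specialization (g := fun i => g i) cF Qm D0 hF).
Qed.

Lemma vec_polyE n (g : nat -> {poly {poly K}}) (w : nat -> K) s r :
  (forall i, (i <= n)%N -> (g i).[r%:P].[s] = w i) ->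
  vec_poly n.+1 g s r = vec n.+1 w.
Proof. by move=> gw; apply/rowP => i; rewrite !mxE gw // -ltnS. Qed.

Lemma eqN_vec n (w : nat -> K) : (6 <= n)%N -> eqN C (hcoord (vec n.+1 w)) = eqN C w.
Proof.
move=> n6; have wE i : (i <= 6)%N -> hcoord (vec n.+1 w) i = w i.
  by move=> i6; rewrite hcoord_vec // (leq_trans i6).
by rewrite /eqN /cubicA /cubicB !wE.
Qed.

Lemma nodal_vec n (w : nat -> K) : (6 <= n)%N -> nodal C (hcoord (vec n.+1 w)) = nodal C w.
Proof.
move=> n6; have wE i : (i <= 6)%N -> hcoord (vec n.+1 w) i = w i.
  by move=> i6; rewrite hcoord_vec // (leq_trans i6).
by rewrite /nodal /cubicA /cubicB !wE.
Qed.

Lemma eqM_vec (w : nat -> K) : eqM C (hcoord (vec 11 w)) = eqM C w.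
Proof. by rewrite /eqM /cubicA /cubicB !hcoord_vec. Qed.

Lemma mpoint_N1_vec (w : nat -> K) :
  mpoint N1_factors (vec (5 + 2) w) <-> nz5 w /\ nz2 (w 5) (w 6).
Proof. by rewrite mpoint_N1 /nz5 !(@hcoord_vec K 6). Qed.

Lemma mpoint_M_vec (w : nat -> K) : mpoint M_factors (vec 11 w) <->
  [/\ nz5 w, nz2 (w 5) (w 6), nz2 (w 7) (w 8) & nz2 (w 9) (w 10)].
Proof. by rewrite mpoint_M /nz5 !hcoord_vec. Qed.

(** Since z_3 : z_4 = y_0 : y_1 is built in, only the second equation of N_1 constrains the
    curve. *)
Definition N_curve (v : nat -> K) (g1 g2 : {poly {poly K}}) s r (i : nat) : K :=
  match i with
  | 0 => v 0 | 1 => g1.[r%:P].[s] | 2 => g2.[r%:P].[s]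
  | 3 => s * v 5 | 4 => s * v 6 | 5 => v 5 | _ => v 6
  end.

Lemma N_curve_specialization (F : set 'rV[K]_(5 + 2)) v g1 g2
    (Q : {poly {poly K}}) (D : {poly K}) :
  zclosed N1_factors F ->
  (forall x, Nvar C x -> ~ nodal C (hcoord x) ->
     (exists2 s, s != 0 & hcoord x 3 = s * hcoord x 5 /\ hcoord x 4 = s * hcoord x 6) ->
     F x) ->
  nz2 (v 5) (v 6) -> Q \is monic -> D != 0 ->
  (forall s r, D.[s] != 0 -> Q.[r%:P].[s] = 0 -> let w := N_curve v g1 g2 s r in
     [/\ s != 0, eqN C w & ~ nodal C w]) ->
  forall s r, Q.[r%:P].[s] = 0 -> nz5 (N_curve v g1 g2 s r) ->
    F (vec (5 + 2) (N_curve v g1 g2 s r)).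
Proof.
move=> cF hF hy Qm D0 hQ s r Qsr hz.
pose g i : {poly {poly K}} := match i with
  | 0 => (v 0)%:P%:P | 1 => g1 | 2 => g2
  | 3 => ('X * (v 5)%:P)%:P | 4 => ('X * (v 6)%:P)%:P
  | 5 => (v 5)%:P%:P | _ => (v 6)%:P%:P end.
have gE s' r' : vec_poly (5 + 2) g s' r' = vec (5 + 2) (N_curve v g1 g2 s' r').
  by apply: (@vec_polyE 6) => -[|[|[|[|[|[|[|i]]]]]]] _ //=; rewrite !hornerE.
rewrite -gE; apply: zclosed_curve cF Qm D0 _ _ _ Qsr _ => [s' r' Ds' Q'|]; last first.
  by rewrite gE; apply/mpoint_N1_vec.
have [s'0 hN nn] := hQ s' r' Ds' Q'; rewrite gE; apply: hF.
- apply/NvarP; rewrite (@eqN_vec 6) //; split => //; apply/mpoint_N1_vec.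
  split=> //; rewrite /nz5 /=; case/orP: hy => y0.
    by rewrite (_ : s' * v 5 != 0) ?orbT // mulf_neq0.
  by rewrite (_ : s' * v 6 != 0) ?orbT // mulf_neq0.
- by rewrite (@nodal_vec 6).
by exists s'; rewrite // !(@hcoord_vec K 6).
Qed.

Lemma monic_quartic (a b : {poly K}) : 'X^4 + (a%:P * 'X + b%:P) \is monic.
Proof.
apply: monicXnD; apply: leq_trans (size_polyD _ _) _.
rewrite geq_max (leq_trans (size_polyC_leq1 _)) // andbT.
rewrite (leq_trans (size_polyMleq _ _)) // size_polyX addn2 /= ltnS.
exact: leq_trans (size_polyC_leq1 _) _.
Qed.

(* Write (z_3, z_4) = s y.  Moving s and solving the second equation, which is a
   quartic in z_1 (in z_2 when y_1 = 0), reaches every point from good ones. *)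
Lemma Nvar_closure (F : set 'rV[K]_(5 + 2)) : zclosed N1_factors F ->
  (forall x, Nvar C x -> ~ nodal C (hcoord x) ->
     (exists2 s, s != 0 & hcoord x 3 = s * hcoord x 5 /\ hcoord x 4 = s * hcoord x 6) ->
     F x) ->
  Nvar C `<=` F.
Proof.
move=> cF hF x /NvarP[xb [e1 e2]]; have [hz hy] := (mpoint_N1 x).1 xb.
set v := hcoord x in e1 e2 hz hy.
have [|s0 [v3 v4]] := nz2_multiple hy (_ : v 5 * v 4 = v 6 * v 3).
  by rewrite mulrC e1 mulrC.
suff [g1 [g2 [Q [D [r0 [Qm D0 hQ Q0 [g10 g20]]]]]]] : exists g1 g2 Q D r0,
    [/\ Q \is monic, D != 0,
        (forall s r, D.[s] != 0 -> Q.[r%:P].[s] = 0 ->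
           let w := N_curve v g1 g2 s r in [/\ s != 0, eqN C w & ~ nodal C w]),
        Q.[r0%:P].[s0] = 0 & g1.[r0%:P].[s0] = v 1 /\ g2.[r0%:P].[s0] = v 2].
  have wE i : (i <= 6)%N -> N_curve v g1 g2 s0 r0 i = v i.
    by case: i => [|[|[|[|[|[|[|i]]]]]]].
  rewrite (_ : x = vec (5 + 2) (N_curve v g1 g2 s0 r0)).
    by apply: (N_curve_specialization cF hF hy Qm D0 hQ Q0); rewrite /nz5 !wE.
  rewrite -[LHS](@vec_hcoord K 6); apply/rowP => i; rewrite !mxE wE //.
  by rewrite -ltnS.
have m0 (a b : K) : a * b = 0 -> a != 0 -> b = 0.
  by move=> /eqP + a0; rewrite mulf_eq0 (negbTE a0) => /eqP.
have s30 (s a : K) : s * a = 0 -> s != 0 -> a != 0 -> False.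
  by move=> /eqP + s_neq0 a_neq0; rewrite mulf_eq0 (negbTE s_neq0) (negbTE a_neq0).
have [v60|v60] := eqVneq (v 6) 0.
  have v50 : v 5 != 0 by move: hy; rewrite /nz2 v60 eqxx orbF.
  (* With y_1 = 0 the second equation is z_2 y_0 B = 0, and [Q] is - z_2 B as a polynomial in z_2.
     [D] excludes s = 0 and z_3^3 = C z_0^3, which every node with y_1 = 0 satisfies. *)
  exists (v 1)%:P%:P, 'X,
    ('X^4 + ((- ((C * v 0 ^+ 3)%:P - (v 5 ^+ 3)%:P * 'X^3))%:P * 'X + 0%:P)),
    ('X * ((v 5 ^+ 3)%:P * 'X^3 - (C * v 0 ^+ 3)%:P)), (v 2).
  split.
  - exact: monic_quartic.
  - by rewrite mulf_neq0 ?polyX_eq0 // cubic_neq0 //; left; rewrite expf_neq0.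
  - move=> s r; rewrite !hevalE mulf_eq0 negb_or => /andP[s0' Ds] Qr; split => //.
      rewrite /eqN /cubicA /cubicB /= v60 !hevalE; split; first by ring.
      by apply: (lincomb1 (q := v 5) Qr); ring.
    have Dn : (s * v 5) ^+ 3 = C * v 0 ^+ 3 -> False.
      move=> h; move/eqP: Ds; apply; rewrite -h; ring.
    move=> /nodal_position-/(_ _ hy)[].
    + by rewrite /= v60; ring.
    + by move=> _ _ _ _ /Dn.
    + by move=> _ _ /= v5; rewrite v5 eqxx in v50.
    + by move=> _ _ _ /Dn.
    + by move=> _ _ _ _ /Dn.
    by move=> _ /= v5; rewrite v5 eqxx in v50.
  - rewrite !hevalE; apply: (mulfI v50).
    by rewrite v60 /cubicB v3 in e2; apply: (lincomb1 (q := 1) e2); ring.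
  - by rewrite !hevalE.
(* Here z_2 is fixed and [Q] is the second equation divided by - y_1, a monic quartic in z_1. Every
   node with y_1 nonzero has z_4^3 = z_0^3, which [D] excludes. *)
exists 'X, (v 2)%:P%:P,
  ('X^4 + ((- ((v 0 ^+ 3)%:P - (v 6 ^+ 3)%:P * 'X^3))%:P * 'X
     + ((v 2 * v 5 / v 6)%:P * ((C * v 0 ^+ 3 - v 2 ^+ 3)%:P - (v 5 ^+ 3)%:P * 'X^3))%:P)),
  ('X * ((v 6 ^+ 3)%:P * 'X^3 - (v 0 ^+ 3)%:P)), (v 1).
split.
- exact: monic_quartic.
- by rewrite mulf_neq0 ?polyX_eq0 // cubic_neq0 //; left; rewrite expf_neq0.
- move=> s r; rewrite !hevalE mulf_eq0 negb_or => /andP[s0' Ds] Qr; split => //.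
    rewrite /eqN /cubicA /cubicB /= !hevalE; split; first by ring.
    by apply: (lincomb1 (q := - v 6) Qr); field.
  have Dn : (s * v 6) ^+ 3 = v 0 ^+ 3 -> False.
    move=> h; move/eqP: Ds; apply; rewrite -h; ring.
  move=> /nodal_position-/(_ _ hy)[].
  + by rewrite /=; ring.
  + by move=> _ _ /= v6; rewrite v6 eqxx in v60.
  + by move=> _ _ _ _ /Dn.
  + by move=> _ _ /Dn.
  + by move=> _ /= v6; rewrite v6 eqxx in v60.
  by move=> _ _ _ /Dn.
- rewrite !hevalE; apply: (mulfI v60).
  by rewrite /cubicB /cubicA v3 v4 in e2; apply: (lincomb1 (q := -1) e2); field.
- by rewrite !hevalE.
Qed.

Definition M_curve (v : nat -> K) (gt gs : {poly {poly K}}) s r (i : nat) : K :=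
  match i with
  | 1 => gt.[r%:P].[s] * v 8 | 2 => gt.[r%:P].[s] * v 7
  | 3 => gs.[r%:P].[s] * v 5 | 4 => gs.[r%:P].[s] * v 6 | _ => v i
  end.

Lemma M_curve_specialization (F : set 'rV[K]_11) v gt gs
    (Q : {poly {poly K}}) (D : {poly K}) :
  zclosed M_factors F ->
  (forall x, Mvar C x -> ~ nodal C (hcoord x) -> F x) ->
  v 0 != 0 -> nz2 (v 5) (v 6) -> nz2 (v 7) (v 8) -> nz2 (v 9) (v 10) ->
  Q \is monic -> D != 0 ->
  (forall s r, D.[s] != 0 -> Q.[r%:P].[s] = 0 -> let w := M_curve v gt gs s r in
     eqM C w /\ ~ nodal C w) ->
  forall s r, Q.[r%:P].[s] = 0 -> F (vec 11 (M_curve v gt gs s r)).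
Proof.
move=> cF hF v0 hy hw hu Qm D0 hQ s r Qsr.
have mb s' r' : mpoint M_factors (vec 11 (M_curve v gt gs s' r')).
  by apply/mpoint_M_vec; split; rewrite /nz5 /= ?v0.
pose g i : {poly {poly K}} := match i with
  | 1 => gt * (v 8)%:P%:P | 2 => gt * (v 7)%:P%:P
  | 3 => gs * (v 5)%:P%:P | 4 => gs * (v 6)%:P%:P | _ => (v i)%:P%:P end.
have gE s' r' : vec_poly 11 g s' r' = vec 11 (M_curve v gt gs s' r').
  by apply: (@vec_polyE 10) => -[|[|[|[|[|i]]]]] _ //=; rewrite !hevalE.
rewrite -gE; apply: zclosed_curve cF Qm D0 _ _ _ Qsr _ => [s' r' Ds' Q'|]; last first.
  by rewrite gE.
have [hM nn] := hQ s' r' Ds' Q'; rewrite gE; apply: hF.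
  by apply/MvarP; rewrite eqM_vec.
by rewrite (@nodal_vec 10).
Qed.

(* With y, w and u fixed, M is a cubic a z_0^3 = b t^3 + g s^3 in the coordinates
   given by (z_1, z_2) = t (w_1, w_0) and (z_3, z_4) = s (y_0, y_1). *)
Lemma M_curve_eq (v : nat -> K) t s :
  (v 0 ^+ 3 - (t * v 8) ^+ 3 - (s * v 6) ^+ 3) * v 9
  - (C * v 0 ^+ 3 - (t * v 7) ^+ 3 - (s * v 5) ^+ 3) * v 10
  = (v 9 - C * v 10) * v 0 ^+ 3 - (v 8 ^+ 3 * v 9 - v 7 ^+ 3 * v 10) * t ^+ 3
    - (v 6 ^+ 3 * v 9 - v 5 ^+ 3 * v 10) * s ^+ 3.
Proof. by ring. Qed.

(** Only nodal points need moving. They have z_0 nonzero; as z_0 stays fixed, the whole curve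
    consists of points of the product, and the excluding polynomials [D] are nonzero. *)
Lemma Mvar_closure (F : set 'rV[K]_11) : zclosed M_factors F ->
  (forall x, Mvar C x -> ~ nodal C (hcoord x) -> F x) -> Mvar C `<=` F.
Proof.
move=> cF hF x Mx; have [nx|nx] := pselect (nodal C (hcoord x)); last exact: hF.
have /MvarP[/mpoint_M[hz hy hw hu] hM] := Mx.
set v := hcoord x in nx hz hy hw hu hM.
have [e1 e2 e3 e4] := hM.
have v0 : v 0 != 0 by exact: node_z0 hz (nodal_position e2 hy nx).
have [|s0 [v3 v4]] := nz2_multiple hy (_ : v 5 * v 4 = v 6 * v 3).
  by rewrite mulrC e2 mulrC.
have [|t0 [v2 v1]] := nz2_multiple hw (_ : v 7 * v 1 = v 8 * v 2).
  by rewrite mulrC e1 mulrC.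
suff [gt [gs [Q [D [s [r [Qm D0 hQ Q0 [gt0 gs0]]]]]]]] : exists gt gs Q D s r,
    [/\ Q \is monic, D != 0,
        (forall s r, D.[s] != 0 -> Q.[r%:P].[s] = 0 ->
           let w := M_curve v gt gs s r in eqM C w /\ ~ nodal C w),
        Q.[r%:P].[s] = 0 & gt.[r%:P].[s] = t0 /\ gs.[r%:P].[s] = s0].
  have wE i : M_curve v gt gs s r i = v i.
    by case: i => [|[|[|[|[|i]]]]] //=; rewrite ?gt0 ?gs0 -?v1 -?v2 -?v3 -?v4.
  rewrite (_ : x = vec 11 (M_curve v gt gs s r)).
    exact: (M_curve_specialization cF hF v0 hy hw hu Qm D0 hQ Q0).
  by rewrite -[LHS](@vec_hcoord K 10); apply/rowP => i; rewrite !mxE wE.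
have hC := M_curve_eq v t0 s0.
rewrite -v1 -v2 -v3 -v4 -/(cubicA v) -/(cubicB C v) e3 subrr in hC.
pose be := v 8 ^+ 3 * v 9 - v 7 ^+ 3 * v 10.
pose ga := v 6 ^+ 3 * v 9 - v 5 ^+ 3 * v 10.
have eqMw gt gs s r : (v 9 - C * v 10) * v 0 ^+ 3 - be * gt.[r%:P].[s] ^+ 3
    - ga * gs.[r%:P].[s] ^+ 3 = 0 -> eqM C (M_curve v gt gs s r).
  rewrite -M_curve_eq => h; split=> /=; [ring|ring| |exact: e4].
  by rewrite /cubicA /cubicB /=; apply/eqP; rewrite -subr_eq0 h.
have [be0|be0] := eqVneq be 0.
  (* With [be = 0] the cubic does not involve t: t becomes the parameter and s stays at [s0]. The
     factors of [D] exclude z_1 = z_2 = 0, z_1^3 = z_0^3 and z_2^3 = C z_0^3, one of which holds at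
     each node. *)
  pose D : {poly K} := 'X * ((v 8 ^+ 3)%:P * 'X^3 - (v 0 ^+ 3)%:P)
     * ((v 7 ^+ 3)%:P * 'X^3 - (C * v 0 ^+ 3)%:P).
  exists 'X%:P, 'X, ('X^1 + (- s0)%:P%:P), D, t0, s0; split.
  - by apply: monicXnD; exact: size_polyC_leq1.
  - rewrite !mulf_neq0 ?polyX_eq0 //; apply: cubic_neq0; right.
      by rewrite expf_neq0.
    by rewrite mulf_neq0 // expf_neq0.
  - move=> s r; rewrite /D !hevalE !mulf_eq0 !negb_or => /andP[/andP[s_neq0 D1] D2].
    rewrite ?expr1 => Qr; have rE : r = s0 by apply/eqP; rewrite -subr_eq0 Qr.
    split.
      apply: eqMw; rewrite !hevalE rE.
      apply: (lincomb2 (q := -1) (q' := t0 ^+ 3 - s ^+ 3) hC be0).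
      by rewrite /ga /be; ring.
    move=> /nodal_position-/(_ _ hy) /= hn.
    have Dw : s * v 8 = 0 -> s * v 7 = 0 -> False.
      by move=> h8 h7; move/eqP: s_neq0; apply; exact: nz2_cancel hw h7 h8.
    have D1n : (s * v 8) ^+ 3 = v 0 ^+ 3 -> False.
      by move=> h; move/eqP: D1; apply; rewrite -h; ring.
    have D2n : (s * v 7) ^+ 3 = C * v 0 ^+ 3 -> False.
      by move=> h; move/eqP: D2; apply; rewrite -h; ring.
    case: hn => /=; rewrite ?hevalE.
    + by ring.
    + by move=> /Dw h /h.
    + by move=> /Dw h /h.
    + by move=> /Dw h /h.
    + by move=> _ _ _ /D1n.
    + by move=> _ _ _ _ /D2n.
  - by rewrite !hevalE; ring.
  - by rewrite !hevalE.
(* Now s is the parameter and t solves the cubic, made monic by dividing by [be]. Nodes are avoided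
   through z_3 if y_1 = 0 and through z_4 otherwise. *)
exists 'X, 'X%:P,
  ('X^3 + (- (be^-1%:P * (((v 9 - C * v 10) * v 0 ^+ 3)%:P - ga%:P * 'X^3)))%:P),
  (if v 6 == 0 then (v 5 ^+ 3)%:P * 'X^3 - (C * v 0 ^+ 3)%:P
   else (v 6 ^+ 3)%:P * 'X^3 - (v 0 ^+ 3)%:P), s0, t0.
split.
- by apply: monicXnD; apply: leq_trans (size_polyC_leq1 _) _.
- by case: ifP => _; apply: cubic_neq0; right; rewrite ?mulf_neq0 ?expf_neq0.
- move=> s r Ds; rewrite !hevalE => Qr; split.
    by apply: eqMw; rewrite !hevalE; apply: (lincomb1 (q := - be) Qr); field.
  move=> /nodal_position-/(_ _ hy) /= hn.
  have [v60|v60] := eqVneq (v 6) 0.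
    have v50 : v 5 != 0 by move: hy; rewrite /nz2 v60 eqxx orbF.
    have Dn : (s * v 5) ^+ 3 = C * v 0 ^+ 3 -> False.
      by move=> h; move/eqP: Ds; rewrite v60 eqxx !hevalE; apply; rewrite -h; ring.
    case: hn => /=; rewrite ?hevalE.
    + by ring.
    + by move=> _ _ _ _ /Dn.
    + by move=> _ _ v5; rewrite v5 eqxx in v50.
    + by move=> _ _ _ /Dn.
    + by move=> _ _ _ _ /Dn.
    by move=> _ v5; rewrite v5 eqxx in v50.
  have Dn : (s * v 6) ^+ 3 = v 0 ^+ 3 -> False.
    by move=> h; move/eqP: Ds; rewrite (negbTE v60) !hevalE; apply; rewrite -h; ring.
  case: hn => /=; rewrite ?hevalE.
  + by ring.
  + by move=> _ _ v6; rewrite v6 eqxx in v60.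
  + by move=> _ _ _ _ /Dn.
  + by move=> _ _ /Dn.
  + by move=> _ v6; rewrite v6 eqxx in v60.
  by move=> _ _ _ /Dn.
- rewrite !hevalE; apply: (mulfI be0).
  by apply: (lincomb1 (q := 1) hC); rewrite -/be -/ga; field.
- by rewrite !hevalE.
Qed.

End Density.

(** * The projection of M to N_1 and its inverse off the nodes *)

Section Resolution.
Variables (K : numClosedFieldType) (C : K).
Hypothesis C0 : C != 0.

Definition proj (x : 'rV[K]_11) : 'rV[K]_(5 + 2) := vec (5 + 2) (hcoord x).

Definition lift_point (x : 'rV[K]_(5 + 2)) : 'rV[K]_11 :=
  vec 11 (lift_coords C (lift_w (hcoord x)) (lift_u C (hcoord x)) (hcoord x)).

Definition N_reg : set 'rV[K]_(5 + 2) := Nvar C `\` @nodal_set K 6 _ N1_factors C.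
Definition M_reg : set 'rV[K]_11 := Mvar C `&` proj @^-1` N_reg.

Lemma N_regP x : N_reg x <->
  [/\ mpoint N1_factors x, eqN C (hcoord x) & ~ nodal C (hcoord x)].
Proof.
rewrite /N_reg /= /setD /= NvarP (nodal_setP (n := 6)).
by split=> [[[? ?] h]|[? ? h]]; split=> //; [move=> ?; apply: h|move=> []].
Qed.

Lemma Mvar_proj x : Mvar C x -> Nvar C (proj x).
Proof.
move=> /MvarP[/mpoint_M[hz hy hw hu] hM]; apply/NvarP; split.
  exact/mpoint_N1_vec.
by rewrite (@eqN_vec _ _ 6) //; exact: eqM_eqN hM.
Qed.

Lemma M_regP x : M_reg x <-> Mvar C x /\ ~ nodal C (hcoord x).
Proof.
rewrite /M_reg /setI /= N_regP (@nodal_vec _ _ 6) //.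
split=> [[Mx []]//|[Mx nx]]; split=> //.
by have /NvarP[] := Mvar_proj Mx; split.
Qed.

Lemma regular_proj (X : set 'rV[K]_11) (Y : set 'rV[K]_(5 + 2)) :
  X `<=` Mvar C -> (forall x, X x -> Y (proj x)) ->
  regular_map M_factors N1_factors X Y proj.
Proof.
move=> XM XY; split=> // x Xx; exists (fun i => var K 10 (val i)) => /=.
have projE y : \row_(i < 5 + 2) peval (var K 10 (val i)) y = proj y.
  by apply/rowP => i; rewrite !mxE peval_var.
split.
- exists (fun j' j => (val j' == val j) : nat); apply: (@forall_inord 6) => i i_le.
  rewrite [val (inord i)]inordK //.
  apply: eq_mhomog (mhomog_var val_M_factors (_ : i <= 10)%N).
    by move=> j; rewrite val_N1_factors.
  exact: leq_trans i_le _.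
- by rewrite projE; have /NvarP[] := Mvar_proj (XM x Xx).
- by move=> y _ _; rewrite projE; exact: same_point_refl.
Qed.

Lemma peval_lift e e' i (y : 'rV[K]_7) :
  peval (lift_coords C%:MP e e' (var K 6) i) y = lift_coords C e e' (hcoord y) i.
Proof.
case: i => [|[|[|[|[|[|[|[|[|[|[|i]]]]]]]]]]]; try exact: peval_var.
all: case: e; case: e'; rewrite /= ?pevalM ?peval_cubicA ?peval_cubicB ?peval_var //.
Qed.

Lemma eqM_lift_w (v : nat -> K) e : nz2 (v 7) (v 8) -> nz2 (v 9) (v 10) -> eqM C v ->
  nz2 (ratio_w C e v).1 (ratio_w C e v).2 ->
  exists2 t, t != 0 & v 7 = t * (ratio_w C e v).1 /\ v 8 = t * (ratio_w C e v).2.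
Proof.
move=> hw hu hM hr; apply: nz2_proportional => //.
by rewrite [RHS]mulrC (eqM_ratio_w _ hw hu hM) mulrC.
Qed.

Lemma eqM_lift_u (v : nat -> K) e : nz2 (v 7) (v 8) -> nz2 (v 9) (v 10) -> eqM C v ->
  nz2 (ratio_u C e v).1 (ratio_u C e v).2 ->
  exists2 t, t != 0 & v 9 = t * (ratio_u C e v).1 /\ v 10 = t * (ratio_u C e v).2.
Proof.
move=> hw hu hM hr; apply: nz2_proportional => //.
by rewrite [RHS]mulrC (eqM_ratio_u _ hw hu hM) mulrC.
Qed.

(** Uniqueness of the point of M over a point of N_1: any nonvanishing expression for w or u
    determines it up to scaling. *)
Lemma same_point_lift (v v' : nat -> K) e e' :
  nz2 (v' 7) (v' 8) -> nz2 (v' 9) (v' 10) -> eqM C v' ->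
  (forall i, (i < 7)%N -> v' i = v i) ->
  nz2 (ratio_w C e v).1 (ratio_w C e v).2 ->
  nz2 (ratio_u C e' v).1 (ratio_u C e' v).2 ->
  same_point M_factors (vec 11 (lift_coords C e e' v)) (vec 11 v').
Proof.
move=> hw hu hM v'v.
have rwE : ratio_w C e v = ratio_w C e v'.
  by case: e; rewrite /= /cubicA /cubicB !v'v.
have ruE : ratio_u C e' v = ratio_u C e' v'.
  by case: e'; rewrite /= /cubicA /cubicB !v'v.
rewrite rwE ruE => /(eqM_lift_w hw hu hM)[tw tw0 [w0 w1]].
move=> /(eqM_lift_u hw hu hM)[tu tu0 [u0 u1]].
apply: (same_point_factor val_M_factors
  (t := fun j => match j with 2 => tw | 3 => tu | _ => 1 end)).
  by case=> [|[|[|[|j]]]] //; exact: oner_neq0.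
move=> i i10; rewrite !hcoord_vec //; move: i10.
case: i => [|[|[|[|[|[|[|[|[|[|[|i]]]]]]]]]]] //= _; try by rewrite v'v ?mul1r.
all: by rewrite ?rwE ?ruE.
Qed.

Lemma mpoint_lift (v : nat -> K) e e' : nz5 v -> nz2 (v 5) (v 6) ->
  nz2 (ratio_w C e v).1 (ratio_w C e v).2 ->
  nz2 (ratio_u C e' v).1 (ratio_u C e' v).2 ->
  mpoint M_factors (vec 11 (lift_coords C e e' v)).
Proof. by move=> hz hy hw hu; apply/mpoint_M_vec. Qed.

Lemma proj_lift_point x : proj (lift_point x) = x.
Proof.
rewrite -[RHS](@vec_hcoord K 6); apply/rowP => i; rewrite !mxE.
by case: i => [[|[|[|[|[|[|[|i]]]]]]] i7] //=; rewrite hcoord_vec.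
Qed.

Lemma Mvar_lift_point x : N_reg x -> Mvar C (lift_point x).
Proof.
move=> /N_regP[/mpoint_N1[hz hy] hN nn]; apply/MvarP; split.
  by apply: mpoint_lift => //; [exact: lift_w_neq0 nn|exact: lift_u_neq0 nn].
by rewrite eqM_vec; exact: lift_eqM.
Qed.

Lemma regular_lift_point : regular_map N1_factors M_factors N_reg M_reg lift_point.
Proof.
split=> [x Nx|x /N_regP[/mpoint_N1[hz hy] hN nn]].
  by split; [exact: Mvar_lift_point|rewrite /= proj_lift_point].
(* The expressions valid at [x] are frozen to give forms. At another point [lift_point] may use
   different expressions, but [same_point_lift] shows that it gives the same point. *)
pose e := lift_w (hcoord x); pose e' := lift_u C (hcoord x).
exists (fun i => lift_coords C%:MP e e' (var K 6) (val i)) => /=.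
have liftE y : \row_(i < 11) peval (lift_coords C%:MP e e' (var K 6) (val i)) y
    = vec 11 (lift_coords C e e' (hcoord y)).
  by apply/rowP => i; rewrite !mxE peval_lift.
have [dw [hw1 hw2]] := mhomog_ratio_w val_N1_factors isT isT C e.
have [du [hu1 hu2]] := mhomog_ratio_u val_N1_factors isT isT C e'.
split.
- exists (fun j' => match val j' with
    | 0 => fun j => (0 == val j) : nat | 1 => fun j => (1 == val j) : nat
    | 2 => dw | _ => du end).
  apply: forall_inord => i i_le; rewrite val_M_factors // [val (inord i)]inordK //.
  have hX l : (l <= 6)%N -> _ := @mhomog_var K 6 _ _ val_N1_factors l.
  case: i i_le => [|[|[|[|[|[|[|[|[|[|[|i]]]]]]]]]]] //= _; exact: hX.
- rewrite liftE; apply: mpoint_lift => //; first exact: lift_w_neq0 nn.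
  exact: lift_u_neq0 nn.
move=> y Ny; rewrite liftE => yb.
have /MvarP[/mpoint_M_vec[_ _ hw hu]] := Mvar_lift_point Ny; rewrite eqM_vec => hM.
have /mpoint_M_vec[_ _ ew eu] := yb.
apply: same_point_lift => //.
by case=> [|[|[|[|[|[|[|i]]]]]]].
Qed.

Lemma proj_isomorphism : isomorphism M_factors N1_factors M_reg N_reg proj.
Proof.
split; first by apply: regular_proj => x [].
exists lift_point; split; first exact: regular_lift_point.
  move=> x [/MvarP[/mpoint_M[_ _ hw hu] hM] /N_regP[_ _ nn]].
  rewrite -[in X in same_point _ _ X](vec_hcoord x).
  have vE i : (i < 7)%N -> hcoord x i = hcoord (proj x) i.
    by move=> i7; rewrite (@hcoord_vec K 6).
  apply: same_point_lift => //; first exact: lift_w_neq0 nn.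
  exact: lift_u_neq0 nn.
by move=> y _; rewrite proj_lift_point; exact: same_point_refl.
Qed.

Lemma N_reg_open : zopen_in N1_factors (Nvar C) N_reg.
Proof.
exists (@nodal_set K 6 _ N1_factors C) => //.
by apply: zclosed_nodal_set => //; exact: val_N1_factors.
Qed.

Lemma M_reg_open : zopen_in M_factors (Mvar C) M_reg.
Proof.
exists (@nodal_set K 10 _ M_factors C).
  by apply: zclosed_nodal_set => //; exact: val_M_factors.
apply/seteqP; split=> x; rewrite M_regP => -[Mx nx]; split=> //.
  by move=> /nodal_setP[].
by move=> nx'; apply: nx; apply/nodal_setP; split=> //; have /MvarP[] := Mx.
Qed.

Lemma N_reg_dense : zdense_in N1_factors (Nvar C) N_reg.
Proof.
split=> [x []//|x Nx F cF NF].
apply: (Nvar_closure cF _ Nx) => y /NvarP[yb hN] ny _.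
by apply: NF; apply/N_regP.
Qed.

Lemma M_reg_dense : zdense_in M_factors (Mvar C) M_reg.
Proof.
split=> [x []//|x Mx F cF MF].
by apply: (Mvar_closure C0 cF _ Mx) => y My ny; apply: MF; apply/M_regP.
Qed.

Lemma exceptional_nodal x : exceptional_set M_factors N1_factors (Mvar C) (Nvar C) proj x ->
  Mvar C x /\ nodal C (hcoord x).
Proof.
move=> [Mx nV]; split=> //; apply: contrapT => nn; apply: nV.
exists N_reg; split; [exact: N_reg_open| |exact: proj_isomorphism].
have [_ Vx] : M_reg x by exact/M_regP.
exact: Vx.
Qed.
End Resolution.

(** * The exceptional curves *)

Section ExceptionalCurves.
Variables (K : numClosedFieldType) (C : K).
Hypothesis C0 : C != 0.

Lemma same_point_blocks (w : nat -> K) (x : 'rV[K]_11) (tz ty tw tu : K) :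
  tz != 0 -> ty != 0 -> tw != 0 -> tu != 0 ->
  (forall i, (i < 11)%N -> hcoord x i =
     match factor i with 0 => tz | 1 => ty | 2 => tw | _ => tu end * w i) ->
  same_point M_factors (vec 11 w) x.
Proof.
move=> tz0 ty0 tw0 tu0 h; apply: (same_point_factor val_M_factors
  (t := fun j => match j with 0 => tz | 1 => ty | 2 => tw | _ => tu end)).
  by case=> [|[|[|j]]].
by move=> i i10; rewrite hcoord_vec // h.
Qed.

(* The points of M over z = (1 : a_1 : a_2 : a_3 : a_4). *)
Definition over_node (a : (K * K) * (K * K)) : set 'rV[K]_11 :=
  zeros M_factors [set p | p \in
    [:: var K 10 1 - a.1.1%:MP * var K 10 0; var K 10 2 - a.1.2%:MP * var K 10 0;
        var K 10 3 - a.2.1%:MP * var K 10 0; var K 10 4 - a.2.2%:MP * var K 10 0]].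

Lemma zclosed_over_node a : zclosed M_factors (over_node a).
Proof.
apply: zclosed_zeros_seq => p.
have h i c : (i < 5)%N -> exists d, mhomog M_factors d (var K 10 i - c%:MP * var K 10 0).
  move=> i5; have i11 : (i <= 10)%N by exact: leq_trans (ltnW i5) _.
  exists (fun j => (0 == val j) : nat); apply: mhomogB.
    apply: eq_mhomog (mhomog_var val_M_factors i11) => j.
    by rewrite /factor i5.
  exact: eq_mhomog (mhomogM (mhomogC _ c) (mhomog_var val_M_factors (isT : (0 <= 10)%N))).
by rewrite !inE => /or4P[] /eqP ->; exact: h.
Qed.

Lemma over_nodeP a x : over_node a x <-> mpoint M_factors x /\
  [/\ hcoord x 1 = a.1.1 * hcoord x 0, hcoord x 2 = a.1.2 * hcoord x 0,
      hcoord x 3 = a.2.1 * hcoord x 0 & hcoord x 4 = a.2.2 * hcoord x 0].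
Proof.
rewrite /over_node zeros_seqP /= !pevalB !pevalM !pevalC !peval_var !subr_eq0 andbT.
by split=> -[xb h]; split=> //; [case/and4P: h => /eqP ? /eqP ? /eqP ? /eqP ?
  |case: h => -> -> -> ->; rewrite !eqxx].
Qed.

(** Over a node z, hence y, is fixed, and the equations of M leave a rational curve for (w, u): only
    u varies, or only w, or both vary linked by the fourth equation. *)
Lemma zdim_le_nodal (E : set 'rV[K]_11) :
  (forall x, E x -> Mvar C x /\ nodal C (hcoord x)) -> zdim_le M_factors E 1.
Proof.
move=> hE.
have data x : E x -> let v := hcoord x in
    [/\ mpoint M_factors x, [/\ nz2 (v 5) (v 6), nz2 (v 7) (v 8) & nz2 (v 9) (v 10)],
        eqM C v, v 0 != 0 & node_position C v].
  move=> /hE[/MvarP[xb hM] nx] v; have [hz hy hw hu] := (mpoint_M x).1 xb.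
  have pos : node_position C v by case: hM => _ e2 _ _; exact: nodal_position e2 hy nx.
  by split=> //; exact: node_z0 hz pos.
(* The polynomial of [node_cubes]. The fibres over all quadruples of its roots are used, whether or
   not the quadruple is a node. *)
pose P : {poly K} := 'X * (1%:P * 'X^3 - 1%:P) * (1%:P * 'X^3 - C%:P).
have P0 : P != 0.
  by rewrite !mulf_neq0 ?polyX_eq0 // cubic_neq0 //; left; exact: oner_neq0.
have [S PS] := closed_field_poly_normal P.
have inS t : root P t -> t \in S.
  by rewrite PS rootZ ?lead_coef_eq0 // root_prod_XsubC.
pose S2 := [seq (a, a') | a <- S, a' <- S].
apply: (@zdim_le_rational_curves K 11 4 M_factors E _
  [seq (p, p') | p <- S2, p' <- S2] over_node zclosed_over_node).
  move=> x Ex; have [xb _ _ v0 pos] := data x Ex; set v := hcoord x in v0 pos.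
  have vS i : (0 < i < 5)%N -> v i / v 0 \in S.
    move=> i5; apply: inS; rewrite rootE /P !hevalE.
    have := node_cubes pos i5 => h; apply/eqP.
    have v07 : v 0 ^+ 7 != 0 by rewrite expf_neq0.
    by apply: (mulfI v07); apply: (lincomb1 (q := 1) h); field.
  exists ((v 1 / v 0, v 2 / v 0), (v 3 / v 0, v 4 / v 0)).
    by apply: allpairs_f; apply: allpairs_f; exact: vS.
  by apply/over_nodeP; split=> //=; rewrite !divfK.
move=> [[a1 a2] [a3 a4]].
suff [G [q hq]] : exists (G : nat -> {poly K}) (q : nat -> K), forall x, E x ->
    over_node ((a1, a2), (a3, a4)) x -> same_point M_factors (vec 11 q) x \/
      exists u, same_point M_factors (vec 11 (fun i => (G i).[u])) x.
  by exists (fun i => G (val i)), (vec 11 q).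
have datay x : E x -> over_node ((a1, a2), (a3, a4)) x -> let v := hcoord x in
    [/\ v 1 = a1 * v 0, v 2 = a2 * v 0, v 3 = a3 * v 0, v 4 = a4 * v 0 &
     exists2 t, t != 0 & v 5 = t * a3 /\ v 6 = t * a4].
  move=> Ex /over_nodeP[_ /= [h1 h2 h3 h4]]; split=> //.
  have [_ [hy _ _] [_ e2 _ _] v0 pos] := data x Ex.
  apply: nz2_proportional => //.
    have := node_z34 C0 v0 pos; rewrite /nz2 h3 h4 !mulf_eq0 !negb_or.
    by rewrite !(negbTE v0) !andbT.
  by apply: (mulfI v0); rewrite h3 h4 in e2; apply: (lincomb1 (q := -1) e2); ring.
pose A' := 1 - a1 ^+ 3 - a4 ^+ 3; pose B' := C - a2 ^+ 3 - a3 ^+ 3.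
have [h12|/negbTE/nz2F[a20 a10]] := boolP (nz2 a2 a1).
  (* Here w is determined by z and u is free; [q] is the point with u_0 = 0. *)
  exists (fun i => match i with
    | 0 => 1 | 1 => a1%:P | 2 => a2%:P | 3 => a3%:P | 4 => a4%:P | 5 => a3%:P
    | 6 => a4%:P | 7 => a2%:P | 8 => a1%:P | 9 => 1 | _ => 'X end).
  exists (fun i => match i with
    | 0 => 1 | 1 => a1 | 2 => a2 | 3 => a3 | 4 => a4 | 5 => a3
    | 6 => a4 | 7 => a2 | 8 => a1 | 9 => 0 | _ => 1 end).
  move=> x Ex Lx; have [_ [hy hw hu] [e1 e2 e3 e4] v0 pos] := data x Ex.
  have [h1 h2 h3 h4 [ty ty0 [h5 h6]]] := datay x Ex Lx.
  have [tw tw0 [h7 h8]] : exists2 t, t != 0 & hcoord x 7 = t * a2 /\ hcoord x 8 = t * a1.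
    apply: nz2_proportional => //; apply: (mulfI v0).
    by rewrite h1 h2 in e1; apply: (lincomb1 (q := -1) e1); ring.
  have [v9|v9] := eqVneq (hcoord x 9) 0.
    left; have v10 : hcoord x 10 != 0 by move: hu; rewrite /nz2 v9 eqxx.
    apply: (same_point_blocks v0 ty0 tw0 v10) => i.
    by case: i => [|[|[|[|[|[|[|[|[|[|[|//]]]]]]]]]]] _ /=;
      rewrite ?mulr1 ?mulr0 // mulrC.
  right; exists (hcoord x 10 / hcoord x 9).
  apply: (same_point_blocks v0 ty0 tw0 v9) => i.
  by case: i => [|[|[|[|[|[|[|[|[|[|[|//]]]]]]]]]]] _ /=;
    rewrite ?hornerC ?hornerX ?mulr1 ?mulr0 // mulrC // divfK.
subst a1 a2.
have dataAB x : E x -> over_node ((0, 0), (a3, a4)) x -> let v := hcoord x in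
    cubicA v = A' * v 0 ^+ 3 /\ cubicB C v = B' * v 0 ^+ 3.
  move=> Ex Lx; have [h1 h2 h3 h4 _] := datay x Ex Lx.
  by rewrite /cubicA /cubicB h1 h2 h3 h4 /A' /B'; split; ring.
have [hAB|/negbTE/nz2F[B0 A0]] := boolP (nz2 B' A').
  (* Here u is determined as B : A and w is free; [q] is the point with w_0 = 0. *)
  exists (fun i => match i with
    | 0 => 1 | 1 | 2 => 0 | 3 => a3%:P | 4 => a4%:P | 5 => a3%:P
    | 6 => a4%:P | 7 => 1 | 8 => 'X | 9 => B'%:P | _ => A'%:P end).
  exists (fun i => match i with
    | 0 => 1 | 1 | 2 => 0 | 3 => a3 | 4 => a4 | 5 => a3
    | 6 => a4 | 7 => 0 | 8 => 1 | 9 => B' | _ => A' end).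
  move=> x Ex Lx; have [_ [hy hw hu] [e1 e2 e3 e4] v0 pos] := data x Ex.
  have [h1 h2 h3 h4 [ty ty0 [h5 h6]]] := datay x Ex Lx.
  have [hA hB] := dataAB x Ex Lx.
  have [tu tu0 [h9 h10]] : exists2 t, t != 0 & hcoord x 9 = t * B' /\ hcoord x 10 = t * A'.
    apply: nz2_proportional => //; apply: (mulfI (expf_neq0 3 v0)).
    by rewrite hA hB in e3; apply: (lincomb1 (q := -1) e3); ring.
  have [v7|v7] := eqVneq (hcoord x 7) 0.
    left; have v8 : hcoord x 8 != 0 by move: hw; rewrite /nz2 v7 eqxx.
    apply: (same_point_blocks v0 ty0 v8 tu0) => i.
    by case: i => [|[|[|[|[|[|[|[|[|[|[|//]]]]]]]]]]] _ /=;
      rewrite ?h1 ?h2 ?mulr1 ?mulr0 ?mul0r // mulrC.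
  right; exists (hcoord x 8 / hcoord x 7).
  apply: (same_point_blocks v0 ty0 v7 tu0) => i.
  by case: i => [|[|[|[|[|[|[|[|[|[|[|//]]]]]]]]]]] _ /=;
    rewrite ?hornerC ?hornerX ?h1 ?h2 ?mulr1 ?mulr0 ?mul0r // mulrC // divfK.
(* When z_1 = z_2 = A = B = 0, z leaves both w and u undetermined. Since a_3 and a_4 are nonzero,
   the fourth equation gives u_0 : u_1 = w_1 a_4 : w_0 a_3, so w alone parametrizes the fibre. *)
have cube_neq0 (t c : K) : c - 0 ^+ 3 - t ^+ 3 = 0 -> c != 0 -> t != 0.
  rewrite expr0n subr0 => h; apply: contraNneq => t0.
  by move: h; rewrite t0 expr0n subr0 => ->.
have a40 := cube_neq0 _ _ A0 (oner_neq0 K); have a30 := cube_neq0 _ _ B0 C0.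
exists (fun i => match i with
  | 0 => 1 | 1 | 2 => 0 | 3 => a3%:P | 4 => a4%:P | 5 => a3%:P
  | 6 => a4%:P | 7 => 1 | 8 => 'X | 9 => 'X * a4%:P | _ => a3%:P end).
exists (fun i => match i with
  | 0 => 1 | 1 | 2 => 0 | 3 => a3 | 4 => a4 | 5 => a3
  | 6 => a4 | 7 => 0 | 8 => 1 | 9 => a4 | _ => 0 end).
move=> x Ex Lx; have [_ [hy hw hu] [e1 e2 e3 e4] v0 pos] := data x Ex.
have [h1 h2 h3 h4 [ty ty0 [h5 h6]]] := datay x Ex Lx.
have [tu tu0 [h9 h10]] : exists2 t, t != 0 &
    hcoord x 9 = t * (hcoord x 8 * a4) /\ hcoord x 10 = t * (hcoord x 7 * a3).
  apply: nz2_proportional => //.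
    by rewrite /nz2 !mulf_eq0 !negb_or a30 a40 !andbT orbC.
  apply: (mulfI ty0).
  by rewrite h5 h6 in e4; apply: (lincomb1 (q := 1) e4); ring.
have [v7|v7] := eqVneq (hcoord x 7) 0.
  left; have v8 : hcoord x 8 != 0 by move: hw; rewrite /nz2 v7 eqxx.
  apply: (same_point_blocks v0 ty0 v8 (mulf_neq0 tu0 v8)) => i.
  by case: i => [|[|[|[|[|[|[|[|[|[|[|//]]]]]]]]]]] _ /=;
    rewrite ?h1 ?h2 ?h3 ?h4 ?h5 ?h6 ?h9 ?h10 ?v7; ring.
right; exists (hcoord x 8 / hcoord x 7).
apply: (same_point_blocks v0 ty0 v7 (mulf_neq0 tu0 v7)) => i.
by case: i => [|[|[|[|[|[|[|[|[|[|[|//]]]]]]]]]]] _ /=;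
  rewrite ?hevalE ?h1 ?h2 ?h3 ?h4 ?h5 ?h6 ?h9 ?h10; field.
Qed.

End ExceptionalCurves.

(** * Smoothness of M *)

Section Smoothness.
Variables (K : numClosedFieldType) (C : K).

Definition pderiv n (x : 'rV[K]_n.+1) (j : nat) (p : {mpoly K[n.+1]}) : K :=
  peval (mderiv (inord j) p) x.

Section Leibniz.
Variables (n : nat) (x : 'rV[K]_n.+1) (j : nat).
Implicit Types p q : {mpoly K[n.+1]}.

Lemma pderivB p q : pderiv x j (p - q) = pderiv x j p - pderiv x j q.
Proof. by rewrite /pderiv mderivB pevalB. Qed.

Lemma pderivM p q :
  pderiv x j (p * q) = pderiv x j p * peval q x + peval p x * pderiv x j q.
Proof. by rewrite /pderiv mderivM pevalD !pevalM. Qed.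

Lemma pderiv_cube p : pderiv x j (p ^+ 3) = 3 * peval p x ^+ 2 * pderiv x j p.
Proof. by rewrite !exprS expr0 mulr1 !pderivM !pevalM; ring. Qed.

Lemma pderivC c : pderiv x j c%:MP = 0.
Proof. by rewrite /pderiv mderivC peval0. Qed.

Lemma pderiv_var i : (i <= n)%N -> (j <= n)%N -> pderiv x j (var K n i) = (i == j)%:R.
Proof.
move=> i_le j_le; rewrite /pderiv /var mderivX mnm1E /peval mevalZ.
have -> : (inord i == inord j :> 'I_n.+1) = (i == j).
  by rewrite -val_eqE /= !inordK.
case: eqP => [->|_]; last by rewrite mul0r.
rewrite (_ : (_ - _)%MM = 0%MM) ?mpolyX0 ?meval1 ?mulr1 //.
by apply/mnmP => l; rewrite mnmBE subnn mnm0E.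
Qed.
End Leibniz.

Lemma smooth_Mvar : C ^+ 5 != 1 -> C != 0 -> smooth_of_dim M_factors (Mvar C) 3.
Proof.
move=> C5 C0; split=> [x /MvarP[]//|x Mx].
have /MvarP[/mpoint_M[hz hy hw hu] [e1 e2 e3 e4]] := Mx.
pose f (i : 'I_4) : {mpoly K[11]} := nth 0 (eqM_forms C%:MP (var K 10)) i.
(* The four equations of M serve at every point, so [h] is 1; the count is 4 equations + 4 factors +
   dimension 3 = 11 coordinates. *)
exists 4, f, 1; split=> //.
- split=> [i|]; last by exists (fun=> 0%N); exact: mhomog1.
  by apply: (@mhomog_eqM _ C); apply: mem_nth.
- by rewrite peval1 oner_neq0.
- move=> y yb _; split=> [[_ hM] i|hf].
    by apply: hM; apply: mem_nth.
  split=> // p /(nthP 0)[i i4 <-]; exact: (hf (Ordinal i4)).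
rewrite -kermx_eq0; apply/rowV0P => l /sub_kermxP lJ.
pose lam i := l ord0 (inord i : 'I_4).
have col j : (j <= 10)%N ->
    lam 0 * pderiv x j (f (inord 0)) + lam 1 * pderiv x j (f (inord 1))
    + lam 2 * pderiv x j (f (inord 2)) + lam 3 * pderiv x j (f (inord 3)) = 0.
  move=> j10; have := congr1 (fun A : 'rV[K]_11 => A ord0 (inord j)) lJ.
  rewrite !mxE !big_ord_recl big_ord0 addr0 !mxE => <-; rewrite !addrA.
  have o0 : ord0 = inord 0 :> 'I_4 by apply: val_inj; rewrite /= inordK.
  have o1 : lift ord0 ord0 = inord 1 :> 'I_4 by apply: val_inj; rewrite /= inordK.
  have o2 : lift ord0 (lift ord0 ord0) = inord 2 :> 'I_4.
    by apply: val_inj; rewrite /= inordK.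
  have o3 : lift ord0 (lift ord0 (lift ord0 ord0)) = inord 3 :> 'I_4.
    by apply: val_inj; rewrite /= inordK.
  by rewrite /lam o1 o2 o3 -o0.
have fE i : (i < 4)%N -> f (inord i) = nth 0 (eqM_forms C%:MP (var K 10)) i.
  by move=> i4; rewrite /f inordK.
(* Kronecker symbols [d i] let a single Leibniz computation cover all eleven columns. *)
have Dcol j : (j <= 10)%N -> let v := hcoord x in let d i : K := (i == j)%:R in
    lam 0 * (d 1 * v 7 + v 1 * d 7 - (d 2 * v 8 + v 2 * d 8))
    + lam 1 * (d 4 * v 5 + v 4 * d 5 - (d 3 * v 6 + v 3 * d 6))
    + lam 2 * ((3 * v 0 ^+ 2 * d 0 - 3 * v 1 ^+ 2 * d 1 - 3 * v 4 ^+ 2 * d 4) * v 9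
               + cubicA v * d 9
               - ((C * (3 * v 0 ^+ 2 * d 0) - 3 * v 2 ^+ 2 * d 2 - 3 * v 3 ^+ 2 * d 3) * v 10
                  + cubicB C v * d 10))
    + lam 3 * ((d 8 * v 6 + v 8 * d 6) * v 10 + v 8 * v 6 * d 10
               - ((d 7 * v 5 + v 7 * d 5) * v 9 + v 7 * v 5 * d 9)) = 0.
  move=> j10 v d; rewrite -[RHS](col j j10) !fE //=.
  rewrite /cubicA /cubicB !(pderivB, pderivM, pderiv_cube, pderivC) !pderiv_var //.
  rewrite !(pevalB, pevalM, pevalXn, pevalC, peval_var).
  by rewrite /d /v; cbv beta; ring.
have [lam0 lam1 lam2 lam3] : [/\ lam 0 = 0, lam 1 = 0, lam 2 = 0 & lam 3 = 0].
  apply: (jacobian_row_free C5 C0 hz hy hw hu e1 e2 e3 e4).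
  - by have := Dcol 0 isT; rewrite /= => c; apply: (lincomb1 (q := 1) c); ring.
  - by have := Dcol 1 isT; rewrite /= => c; apply: (lincomb1 (q := 1) c); ring.
  - by have := Dcol 2 isT; rewrite /= => c; apply: (lincomb1 (q := -1) c); ring.
  - by have := Dcol 3 isT; rewrite /= => c; apply: (lincomb1 (q := -1) c); ring.
  - by have := Dcol 4 isT; rewrite /= => c; apply: (lincomb1 (q := 1) c); ring.
  - by have := Dcol 7 isT; rewrite /= => c; apply: (lincomb1 (q := 1) c); ring.
  - by have := Dcol 8 isT; rewrite /= => c; apply: (lincomb1 (q := -1) c); ring.
  - by have := Dcol 5 isT; rewrite /= => c; apply: (lincomb1 (q := 1) c); ring.
  - by have := Dcol 6 isT; rewrite /= => c; apply: (lincomb1 (q := -1) c); ring.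
  - by have := Dcol 9 isT; rewrite /= => c; apply: (lincomb1 (q := 1) c); rewrite /cubicA; ring.
  - by have := Dcol 10 isT; rewrite /= => c; apply: (lincomb1 (q := -1) c); rewrite /cubicB; ring.
by apply/rowP; apply: forall_inord => -[|[|[|[|//]]]] _; rewrite mxE.
Qed.
End Smoothness.

Lemma Mvar_resolution (K : numClosedFieldType) (C : K) : C ^+ 5 != 1 -> C != 0 ->
  projective_small_resolution M_factors N1_factors (Mvar C) (Nvar C) (@proj K).
Proof.
move=> C5 C0; split.
- exists (Mvar C); first exact: zclosed_Mvar.
  by exists set0; [exact: zclosed0|rewrite setD0].
- by apply: zclosed_projective => //; exact: zclosed_Mvar.
- exact: smooth_Mvar.
- by apply: regular_proj; [exact: subset_refl|exact: Mvar_proj].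
- exists (M_reg C), (N_reg C); split.
  + by split; [exact: M_reg_open|exact: M_reg_dense].
  + by split; [exact: N_reg_open|exact: N_reg_dense].
  exact: proj_isomorphism.
by apply: (zdim_le_nodal C0) => x; exact: exceptional_nodal.
Qed.

(** * The blow-up of D_0 *)

Section BlowUp.
Variables (R : realType) (c : R).
Local Notation K := R[i].
Local Notation C := (c%:C)%C.

Lemma hcoord_lsubmx (y : 'rV[K]_(5 + 2)) i : (i < 5)%N ->
  hcoord (lsubmx y : 'rV_5) i = hcoord y i.
Proof.
move=> i5; rewrite /hcoord mxE; congr (y _ _); apply: val_inj.
by rewrite /= !inordK // (leq_trans i5).
Qed.

Lemma hcoord_rsubmx (y : 'rV[K]_(5 + 2)) i : (i < 2)%N ->
  hcoord (rsubmx y : 'rV_2) i = hcoord y (5 + i).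
Proof.
move=> i2; rewrite /hcoord mxE; congr (y _ _); apply: val_inj.
by rewrite /= !inordK // -[(5 + i < _)%N]/(5 + i < 5 + 2)%N ltn_add2l.
Qed.

Lemma mpoint_PP m (x : 'rV[K]_m.+1) :
  mpoint (PP m) x <-> exists2 i, (i <= m)%N & hcoord x i != 0.
Proof.
split=> [/(_ ord0)[l _ xl]|[l l_le xl] j].
  by exists (val l); [rewrite -ltnS ltn_ord|rewrite /hcoord inord_val].
by exists (inord l) => //; rewrite [j]ord1 [LHS]ord1.
Qed.

Lemma N0P (x : 'rV[K]_5) : N0 c x <-> nz5 (hcoord x) /\
  hcoord x 1 * hcoord x 4 * cubicA (hcoord x)
  = hcoord x 2 * hcoord x 3 * cubicB C (hcoord x).
Proof.
have qE : peval (quintic c) x = hcoord x 1 * hcoord x 4 * cubicA (hcoord x)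
    - hcoord x 2 * hcoord x 3 * cubicB C (hcoord x).
  rewrite /quintic -[z R 0]/(var K 4 0) -[z R 1]/(var K 4 1) -[z R 2]/(var K 4 2).
  rewrite -[z R 3]/(var K 4 3) -[z R 4]/(var K 4 4).
  by rewrite !(pevalB, pevalM, pevalXn, pevalC, peval_var) /cubicA /cubicB.
have mE : mpoint (PP 4) x <-> nz5 (hcoord x).
  rewrite mpoint_PP /nz5; split=> [[l]|].
    by do 5?[case: l => [|l] //]; move=> _ ->; rewrite ?orbT.
  by case/or4P => [h|h|h|/orP[h|h]]; [exists 0%N|exists 1%N|exists 2%N|exists 3%N|exists 4%N].
split=> [[/mE hx /(_ _ erefl)/eqP]|[/mE hx /eqP]].
  by rewrite qE subr_eq0 => /eqP.
by rewrite -subr_eq0 -qE => /eqP q0; split=> // _ ->.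
Qed.

Lemma row_D0_eqs (x : 'rV[K]_5) (i : nat) : (i < 2)%N ->
  (\row_l peval (D0_eqs R l) x) ord0 (inord i : 'I_2) = hcoord x (3 + i).
Proof.
move=> i2; rewrite mxE /D0_eqs -val_eqE /= inordK //.
by case: i i2 => [|[|//]] _ /=; exact: peval_var.
Qed.

Lemma graph_D0P (y : 'rV[K]_(5 + 2)) : let v := hcoord y in
  [/\ N0 c (lsubmx y), mpoint (PP 1) (rsubmx y)
    & same_point (PP 1) (rsubmx y) (\row_i peval (D0_eqs R i) (lsubmx y))]
  <-> [/\ nz5 v, v 1 * v 4 * cubicA v = v 2 * v 3 * cubicB C v, nz2 (v 5) (v 6)
        & exists2 s, s != 0 & v 3 = s * v 5 /\ v 4 = s * v 6].
Proof.
move=> v; rewrite (propext (N0P _)) (propext (mpoint_PP _)) /nz5 /cubicA /cubicB !hcoord_lsubmx // -/v.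
have yE : (exists2 l, (l <= 1)%N & hcoord (rsubmx y : 'rV_2) l != 0) <-> nz2 (v 5) (v 6).
  split=> [[[|[|//]] _]|]; rewrite ?hcoord_rsubmx // /nz2 => h; rewrite ?h ?orbT //.
  by case/orP: h => h; [exists 0%N|exists 1%N]; rewrite ?hcoord_rsubmx.
rewrite (propext yE); split=> [[[hz hq] hy [t t0 tE]]|[hz hq hy [s s0 [h3 h4]]]].
  split=> //; exists (t ord0) => //.
  have := tE (inord 0); have := tE (inord 1).
  rewrite !row_D0_eqs // !hcoord_lsubmx // -!/(hcoord (rsubmx y : 'rV_2) _).
  by rewrite !hcoord_rsubmx // ![PP 1 _]ord1.
split=> //; exists (fun=> s) => //; apply: (@forall_inord 1) => -[|[|//]] _.
  by rewrite row_D0_eqs // hcoord_lsubmx // -/(hcoord (rsubmx y : 'rV_2) _) hcoord_rsubmx.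
by rewrite row_D0_eqs // hcoord_lsubmx // -/(hcoord (rsubmx y : 'rV_2) _) hcoord_rsubmx.
Qed.

(** The graph lies in the closed set [Nvar C]. Conversely, points of [Nvar C] with (z_3, z_4) a
    nonzero multiple of y lie on the graph, and [Nvar_closure] needs only such points. *)
Lemma N1_Nvar : N1 c = Nvar C.
Proof.
apply/seteqP; split=> x.
  apply; first exact: zclosed_Nvar.
  move=> y /graph_D0P[hz hq hy [s s0 [h3 h4]]]; apply/NvarP.
  split; first exact/mpoint_N1.
  split; first by rewrite h3 h4; ring.
  apply: (mulfI s0); rewrite h3 h4 in hq.
  by apply: (lincomb1 (q := 1) hq); ring.
move=> Nx F cF FG; apply: (Nvar_closure cF _ Nx).
move=> y /NvarP[/mpoint_N1[hz hy] [_ hN]] _ [s s0 [h3 h4]]; apply: FG.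
apply/graph_D0P; split=> //; last by exists s.
by rewrite h3 h4; apply: (lincomb1 (q := s) hN); ring.
Qed.
End BlowUp.

Theorem mainTheorem9 (R : realType) :
  exists c0 : R, forall c : R, 0 < c -> c0 < c ->
    exists (n k : nat) (b : 'I_n -> 'I_k) (M : set 'rV[R[i]]_n)
           (phi : 'rV[R[i]]_n -> 'rV[R[i]]_(5 + 2)),
      projective_small_resolution b N1_factors M (N1 c) phi.
Proof.
(* The bound 1 ensures c^5 different from 1 and c nonzero, the conditions under which M is a
   resolution. *)
exists 1 => c c_gt0 c_gt1; set C := (c%:C)%C.
have C1 : 1 < C by rewrite -[1]/(1%:C)%C ltcR.
have C0 : C != 0 by rewrite gt_eqF // (lt_trans ltr01).
have C5 : C ^+ 5 != 1 by rewrite gt_eqF // exprn_egt1.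
exists 11, 4, M_factors, (Mvar C), (@proj _); rewrite N1_Nvar.
exact: Mvar_resolution.
Qed.
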